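(* Let $\rho:\mathbb{R}^n\to\mathbb{R}$ be such that $\int_{\mathbb{R}^n}\rho(x)\,dx=1$ and $\operatorname{supp}\rho=B_1$, and let $\rho_\varepsilon(x)=\varepsilon^{-n}\rho(x/\varepsilon)$ for $\varepsilon>0$. There exists $C=C(n)$, depending only on $n$, such that, for every $u\in W^{s,p}(\mathbb{R}^n)$ with $p\in[1,\infty]$ and $s\in[0,1]$, we have $$\|\rho_\varepsilon*u-u\|_{L^p(\mathbb{R}^n)}\le C\,[u]_{W^{s,p}(\mathbb{R}^n)}\,\varepsilon^s .$$ Furthermore, if $\rho$ is even (i.e. $\rho(y)=\rho(-y)$), the result holds for $s\in[0,2]$.
   Context: $n\ge 1$ is the dimension and $B_1$ is the (closed) unit ball of $\mathbb{R}^n$ centred at the origin. For $s\in(0,1)$ and $p\in[1,\infty)$ the normalised Gagliardo seminorm is $$[u]_{W^{s,p}(\mathbb{R}^n)}=\left(s(1-s)\int_{\mathbb{R}^n}\int_{\mathbb{R}^n}\frac{|u(x)-u(y)|^p}{|x-y|^{n+sp}}\,dx\,dy\right)^{1/p}.$$ In the limit cases: $[u]_{W^{0,p}(\mathbb{R}^n)}=\|u\|_{L^p(\mathbb{R}^n)}$ and $[u]_{W^{1,p}(\mathbb{R}^n)}=\|\nabla u\|_{L^p(\mathbb{R}^n)}$ for $p\in[1,\infty]$, and $[u]_{W^{s,\infty}(\mathbb{R}^n)}=\operatorname{ess\,sup}_{x,y\in\mathbb{R}^n}\frac{|u(x)-u(y)|}{|x-y|^s}$ for $s\in(0,1)$.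 For $s\in[0,1]$, $W^{s,p}(\mathbb{R}^n)=\{u\in L^p(\mathbb{R}^n):[u]_{W^{s,p}(\mathbb{R}^n)}<+\infty\}$. For $s=1+\sigma$ with $\sigma\in(0,1]$, $[u]_{W^{s,p}(\mathbb{R}^n)}=\max_{1\le i\le n}[\partial_{x_i}u]_{W^{\sigma,p}(\mathbb{R}^n)}$ (weak derivatives) and $W^{s,p}(\mathbb{R}^n)=\{u\in W^{1,p}(\mathbb{R}^n):[u]_{W^{s,p}(\mathbb{R}^n)}<+\infty\}$.
   Formalization: For sign-changing ρ no C depending only on n exists (s=0, p=1, u near a Dirac mass forces C ≥ ‖ρ‖₁+1), so C=C(n) is proved for nonnegative ρ; for arbitrary ρ the constant C may depend on n and ρ, but not on s, p, u, ε. *)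

(* Defs.v *)
From HB Require Import structures.
From mathcomp Require Import all_boot all_order all_algebra.
From mathcomp Require Import all_classical all_reals all_analysis.
From mathcomp Require Import ess_sup_inf.

Set Implicit Arguments.
Unset Strict Implicit.
Unset Printing Implicit Defensive.

Import Order.TTheory GRing.Theory Num.Theory.
Import numFieldNormedType.Exports.

Local Open Scope classical_set_scope.
Local Open Scope ring_scope.

(** The space R^n is ['rV[R]_n]. Its sigma-algebra is the one generated by the
    coordinates, i.e. the Borel sigma-algebra. *)

Definition measure_row_display : measure_display.
Proof. exact: default_measure_display. Qed.

Section measurable_row.
Context {R : realType} (n : nat).

Let coors : 'I_n -> 'rV[R]_n -> measurableTypeR R := fun i x => x ord0 i.

Let row_set0 : g_sigma_preimage coors set0.
Proof. exact: sigma_algebra0. Qed.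

Let row_setC A : g_sigma_preimage coors A -> g_sigma_preimage coors (~` A).
Proof. exact: sigma_algebraC. Qed.

Let row_bigcup (F : _^nat) : (forall i, g_sigma_preimage coors (F i)) ->
  g_sigma_preimage coors (\bigcup_i (F i)).
Proof. exact: sigma_algebra_bigcup. Qed.

HB.instance Definition _ := @isMeasurable.Build measure_row_display
  'rV[R]_n (g_sigma_preimage coors) row_set0 row_setC row_bigcup.

Lemma measurable_coord (i : 'I_n) :
  measurable_fun [set: 'rV[R]_n] (fun x => x ord0 i : measurableTypeR R).
Proof.
move=> _ Y mY; rewrite setTI; apply: sub_sigma_algebra => /=.
rewrite -bigcup_seq/=; exists i => /=; first by rewrite mem_index_enum.
by exists Y => //; rewrite setTI.
Qed.

Lemma measurable_fun_row d (T : measurableType d) (f : T -> 'rV[R]_n) :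
  (forall i, measurable_fun [set: T] (fun t => f t ord0 i : measurableTypeR R)) ->
  measurable_fun [set: T] f.
Proof.
move=> mf _ A mA; rewrite setTI.
have : g_sigma_preimage (fun i => coors i \o f) (f @^-1` A).
  by rewrite g_sigma_preimage_comp; exists A => //; rewrite setTI.
apply: smallest_sub; first exact: sigma_algebra_measurable.
by rewrite -bigcup_seq/=; apply: bigcup_sub => i _ B [C mC <-]; exact: mf.
Qed.

End measurable_row.

Section lebesgue_step.
Context {R : realType} (n : nat).

Definition row_cons (z : measurableTypeR R * 'rV[R]_n) : 'rV[R]_n.+1 :=
  row_mx (z.1%:M : 'M[R]_1) z.2.

Lemma row_cons_ord0 z : row_cons z ord0 ord0 = z.1.
Proof.
rewrite /row_cons (_ : ord0 = lshift n (ord0 : 'I_1)); last exact: val_inj.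
by rewrite [LHS](@row_mxEl _ 1 1 n) mxE eqxx mulr1n.
Qed.

Lemma row_cons_lift z (i : 'I_n) : row_cons z ord0 (lift ord0 i) = z.2 ord0 i.
Proof.
rewrite /row_cons (_ : lift ord0 i = rshift 1 i); last exact: val_inj.
by rewrite [LHS](@row_mxEr _ 1 1 n).
Qed.

Lemma measurable_row_cons : measurable_fun [set: _] row_cons.
Proof.
apply: measurable_fun_row => i; have [j ->|->] := unliftP ord0 i.
  under eq_fun do rewrite row_cons_lift.
  exact: (measurableT_comp (measurable_coord j) measurable_snd).
by under eq_fun do rewrite row_cons_ord0; exact: measurable_fst.
Qed.

HB.instance Definition _ := isMeasurableFun.Build _ _ _ _ row_cons
  measurable_row_cons.

Variable m : {sigma_finite_measure set 'rV[R]_n -> \bar R}.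

Definition lebesgue_step : set 'rV[R]_n.+1 -> \bar R :=
  pushforward (lebesgue_measure \x m)%E row_cons.

Let lebesgue_step0 : lebesgue_step set0 = 0%E.
Proof. exact: measure0. Qed.

Let lebesgue_step_ge0 A : (0 <= lebesgue_step A)%E.
Proof. exact: measure_ge0. Qed.

Let lebesgue_step_sigma_additive : semi_sigma_additive lebesgue_step.
Proof. exact: measure_semi_sigma_additive. Qed.

HB.instance Definition _ := isMeasure.Build _ _ _ lebesgue_step
  lebesgue_step0 lebesgue_step_ge0 lebesgue_step_sigma_additive.

Let lebesgue_step_sigma_finite : sigma_finite setT lebesgue_step.
Proof.
have /sigma_finiteP[F [FT ndF Foo]] := sigma_finiteT (@lebesgue_measure R).
have /sigma_finiteP[G [GT ndG Goo]] := sigma_finiteT m.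
pose g (x : 'rV[R]_n.+1) : measurableTypeR R * 'rV[R]_n :=
  (x ord0 ord0, \row_i x ord0 (lift ord0 i)).
have mg : measurable_fun [set: _] g.
  apply/measurable_fun_pairP; split; first exact: measurable_coord.
  apply: measurable_fun_row => i /=; under eq_fun do rewrite mxE.
  exact: measurable_coord.
have gK z : g (row_cons z) = z.
  rewrite /g row_cons_ord0 [z in RHS]surjective_pairing; congr (_, _).
  by apply/rowP => i; rewrite mxE row_cons_lift.
exists (fun k => g @^-1` (F k `*` G k)).
  rewrite -preimage_bigcup; apply/esym/seteqP; split=> // x _ /=.
  have [i _ Fi] : (\bigcup_i F i) (g x).1 by rewrite -FT.
  have [j _ Gj] : (\bigcup_i G i) (g x).2 by rewrite -GT.
  exists (maxn i j) => //; split.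
  - by move: Fi; exact/subsetPset/ndF/leq_maxl.
  - by move: Gj; exact/subsetPset/ndG/leq_maxr.
move=> k; have [mFk Fkoo] := Foo k; have [mGk Gkoo] := Goo k; split.
  by rewrite -[X in measurable X]setTI; apply: mg => //; exact: measurableX.
rewrite /lebesgue_step /pushforward (_ : _ @^-1` _ = F k `*` G k).
  by rewrite product_measure1E// lte_mul_pinfty// ge0_fin_numE.
by rewrite -comp_preimage (_ : g \o row_cons = id)//; apply/funext => z; exact: gK.
Qed.

HB.instance Definition _ := Measure_isSigmaFinite.Build _ _ _ lebesgue_step
  lebesgue_step_sigma_finite.

End lebesgue_step.

(** Lebesgue measure on R^n: point mass for n = 0, and the product of the
    one-dimensional measure (first coordinate) with the measure on R^n for
    n + 1. *)
Fixpoint lebesgue_row {R : realType} (n : nat) :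
    {sigma_finite_measure set 'rV[R]_n -> \bar R} :=
  match n with
  | 0 => dirac (0 : 'rV[R]_0)
  | n'.+1 => lebesgue_step (lebesgue_row n')
  end.

Section gagliardo_sobolev.
Context {R : realType} (n : nat).
Local Notation V := 'rV[R]_n.
Local Notation mu := (@lebesgue_row R n).
Implicit Types (u v f g phi rho : V -> R) (s e C : R) (p : \bar R) (i : 'I_n).

(** The norm that the library puts on ['rV[R]_n] is the sup norm; lengths in
    R^n are measured here by the Euclidean norm. *)
Definition enorm (x : V) : R := Num.sqrt (\sum_(j < n) x ord0 j ^+ 2).

Definition unit_ball : set V := [set x | enorm x <= 1].

Definition supp f : set V := closure [set x | f x != 0].

Definition partial i f : V -> R := 'D_(delta_mx ord0 i) f.

Fixpoint is_Ck (k : nat) f : Prop :=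
  match k with
  | 0 => continuous f
  | k'.+1 => continuous f /\
      forall i, (forall x, derivable f x (delta_mx ord0 i)) /\
                is_Ck k' (partial i f)
  end.

Definition test_function phi : Prop :=
  (forall k, is_Ck k phi) /\ compact (supp phi).

Definition loc_integrable f : Prop :=
  measurable_fun [set: V] f /\
  forall K : set V, compact K -> mu.-integrable K (EFin \o f).

Definition is_weak_partial i u v : Prop :=
  [/\ loc_integrable u, loc_integrable v &
    forall phi, test_function phi ->
      \int[mu]_x (u x * partial i phi x) = - \int[mu]_x (v x * phi x)].

Definition weakly_differentiable u : Prop :=
  forall i, exists v, is_weak_partial i u v.

(** The weak derivative, unique up to a null set; 0 when there is none. *)
Definition weak_partial i u : V -> R :=
  xget (cst 0) [set v | is_weak_partial i u v].

Definition weak_grad u (x : V) : V := \row_i weak_partial i u x.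

Definition gagliardo s p u : \bar R :=
  match p with
  | p'%:E =>
    ((s * (1 - s))%:E *
     \int[mu]_y \int[mu]_x
       (`|u x - u y| `^ p' / enorm (x - y) `^ (n%:R + s * p'))%:E) `^ p'^-1
  | _ => ess_sup (mu \x mu)
           (fun z => (`|u z.1 - u z.2| / enorm (z.1 - z.2) `^ s)%:E)
  end%E.

(** Meaningful for s in [0, 1]; [seminorm] below covers s in [0, 2]. A function
    without weak gradient gets an infinite W^{1,p} seminorm. *)
Definition seminorm01 s p u : \bar R :=
  if s == 0 then 'N[mu]_p[EFin \o u]%E
  else if s == 1 then
    if `[< weakly_differentiable u >]
    then 'N[mu]_p[EFin \o (enorm \o weak_grad u)]%E else +oo%E
  else gagliardo s p u.

Definition seminorm s p u : \bar R :=
  if s <= 1 then seminorm01 s p u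
  (* -oo is neutral for max; the range is non-empty when n >= 1 *)
  else \big[Order.max/-oo%E]_(i < n) seminorm01 (s - 1) p (weak_partial i u).

Definition sobolev s p : set (V -> R) :=
  if s <= 1 then [set u | u \in Lfun mu p /\ (seminorm s p u < +oo)%E]
  else [set u | [/\ u \in Lfun mu p, (seminorm 1 p u < +oo)%E &
                    (seminorm s p u < +oo)%E]].

Definition rescale rho e : V -> R := fun x => e ^- n * rho (e^-1 *: x).

Definition convol f g : V -> R := fun x => \int[mu]_y (f (x - y) * g y).

Definition unit_kernel rho : Prop :=
  [/\ mu.-integrable [set: V] (EFin \o rho), (\int[mu]_x (rho x)%:E = 1)%E &
      supp rho = unit_ball].

Definition even_kernel rho : Prop := forall y, rho (- y) = rho y.

Definition mollification_estimate rho C s : Prop :=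
  forall p u e, (1 <= p)%E -> sobolev s p u -> 0 < e ->
    ('N[mu]_p[EFin \o (convol (rescale rho e) u \- u)%R]
       <= C%:E * seminorm s p u * (e `^ s)%:E)%E.

Definition mollification_rate rho C : Prop :=
  (forall s, 0 <= s <= 1 -> mollification_estimate rho C s) /\
  (even_kernel rho -> forall s, 0 <= s <= 2 -> mollification_estimate rho C s).

End gagliardo_sobolev.

(* Main.v *)
Require Import Defs.
From HB Require Import structures.
From mathcomp Require Import all_boot all_order all_algebra.
From mathcomp Require Import all_classical all_reals all_analysis.
From mathcomp Require Import ess_sup_inf measurable_realfun ring lra.

Set Implicit Arguments.
Unset Strict Implicit.
Unset Printing Implicit Defensive.

Import Order.TTheory GRing.Theory Num.Theory.
Import numFieldNormedType.Exports.

Local Open Scope classical_set_scope.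
Local Open Scope ring_scope.

(** Write shift_diff h u x = u (x + h) - u x. As rho has integral 1, the error
    rho_e * u - u is the average of shift_diff (- y) u against rho_e(y) dy, and
    Minkowski's integral inequality [Lnorm_integral_le] bounds its L^p norm by
    ||rho||_1 times the supremum of ||shift_diff h u||_p over |h| <= e. The
    theorem thus reduces to
<<
      ||shift_diff h u||_p <= C(n) r^s [u]_{s,p}   whenever |h| <= r,
>>
    with C(n) independent of s and p ([Lnorm_shift_diff_seminorm01]). A
    nonnegative kernel has ||rho||_1 = 1, which makes the final constant depend
    on n alone.

    For s = 0 this is the triangle inequality. For 0 < s < 1 and p < oo, the
    function w(h) = ||shift_diff h u||_p is even and subadditive, and [u]_{s,p}^p
    is s(1-s) times the integral of w(y)^p / |y|^(n+sp). Subadditivity bounds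
    w(h) by the average of w over a shell of comparable radius
    ([shell_bound]). One shell loses the factor s(1-s), which must not enter the
    constant; it is recovered by summing over a geometric sequence of disjoint
    shells, larger and larger ones when s <= 1/2, smaller and smaller ones when
    s > 1/2 ([gagliardo_gain]). For p = oo the Hoelder bound holds for almost
    all h, hence for all h, each h being a difference of two good vectors.

    For s = 1 the estimate follows from u(x + t e_i) - u(x) being the integral
    over [0, t] of the weak partial derivative of u along the segment, for
    almost every x ([weak_directional_ftc]). Both sides have the same integral
    against every smooth bump, by Fubini's theorem, translation invariance and
    the classical fundamental theorem for the bump; and bumps separate locally
    integrable functions, because they converge to indicators of boxes
    ([fundamental_lemma]).

    If rho is even, the average of shift_diff (- y) u equals that of
    shift_diff y u, so twice the error is the average of the second difference
    u(x + y) + u(x - y) - 2 u(x). The latter is, up to sign, the difference of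
    step y of shift_diff (- y) u, whose weak partial derivatives are the
    differences of step - y of those of u. The case s = 1 for the outer
    difference and the case s - 1 for the inner one give the bound in r^s for
    1 < s <= 2 ([Lnorm_second_diff]). *)

(** * Boxes, and Lebesgue measure under affine maps *)

Section boxes.
Context {R : realType}.

Definition box n (a b : 'I_n -> R) : set 'rV[R]_n :=
  [set x | forall i, a i < x ord0 i < b i].

Lemma measurable_box n (a b : 'I_n -> R) : measurable (box a b).
Proof.
have -> : box a b = \bigcap_(i in [set: 'I_n])
    ((fun x : 'rV[R]_n => x ord0 i) @^-1` `]a i, b i[%classic).
  apply/seteqP; split=> [x bx i _ /=|x bx i]; first by rewrite in_itv/= bx.
  by have := bx i I; rewrite /= in_itv.
apply: fin_bigcap_measurable => // i _; rewrite -[X in measurable X]setTI.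
by apply: measurable_coord => //; exact: measurable_itv.
Qed.

Lemma lebesgue_row_box n (a b : 'I_n -> R) :
  lebesgue_row n (box a b) = (\prod_(i < n) Num.max 0 (b i - a i))%:E.
Proof.
elim: n a b => [|n IH] a b.
  rewrite big_ord0 /= diracE (_ : _ \in _)// inE => -[]//.
rewrite big_ord_recl/= /lebesgue_step /pushforward.
have -> : row_cons (n := n) @^-1` box a b =
    `]a ord0, b ord0[%classic `*` box (a \o lift ord0) (b \o lift ord0).
  apply/seteqP; split=> [z bz|z [/= bz0 bz] i].
    split=> [|i] /=; first by have := bz ord0; rewrite row_cons_ord0/= in_itv.
    by have := bz (lift ord0 i); rewrite row_cons_lift.
  have [j ->|->] := unliftP ord0 i; first by rewrite row_cons_lift; exact: bz.
  by rewrite row_cons_ord0; move: bz0; rewrite in_itv.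
rewrite product_measure1E//; last exact: measurable_box.
rewrite IH [X in (X * _)%E](lebesgue_measure_itv `]a ord0, b ord0[)/= lte_fin; case: ltP => ab.
  by rewrite EFinM max_r// subr_ge0 ltW.
by rewrite mul0e max_l ?mul0r// subr_le0.
Qed.

Definition cube n (k : nat) : set 'rV[R]_n := box (fun=> - k%:R) (fun=> k%:R).
Arguments cube n k : clear implicits.

Lemma bigcup_cube n : \bigcup_k cube n k = setT.
Proof.
apply/seteqP; split=> // x _.
exists (Num.bound `|x|) => // i /=; rewrite -ltr_norml.
apply: le_lt_trans (archi_boundP (normr_ge0 x)).
by rewrite [leRHS]mx_normrE (bigmax_sup (ord0, i)).
Qed.

(** Boxes form a pi-system that generates the sigma-algebra: a slab in one
    coordinate is the increasing union of the boxes that it cuts out of the cubes. *)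
Lemma measurable_rowE n :
  @measurable _ 'rV[R]_n = <<s [set B | exists a b, B = box a b] >>.
Proof.
apply/seteqP; split; last first.
  apply: smallest_sub; first exact: sigma_algebra_measurable.
  by move=> _ [a [b ->]]; exact: measurable_box.
apply: smallest_sub; first exact: smallest_sigma_algebra.
rewrite -bigcup_seq/=; apply: bigcup_sub => i _ _ [C mC <-].
pose T := g_sigma_algebraType [set B : set 'rV[R]_n | exists a b, B = box a b].
rewrite setTI.
have : measurable_fun [set: T] (fun x : T => (x : 'rV[R]_n) ord0 i : measurableTypeR R).
  apply: (@measurability _ _ T (measurableTypeR R) _ _ _
    (RGenOpens.measurableE R)) => _ [_ [a [b ->]] <-].
  rewrite setTI.
  have -> : (fun x : 'rV[R]_n => x ord0 i) @^-1` `]a, b[%classic =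
    \bigcup_k box (fun j => if j == i then a else - k%:R)
                  (fun j => if j == i then b else k%:R).
    apply/seteqP; split=> [x /= xab|x [k _] /(_ i)]; last by rewrite eqxx/= in_itv.
    have [k _ xk] : (\bigcup_k cube n k) x by rewrite bigcup_cube.
    by exists k => // j; case: eqP => [->|_]; [rewrite in_itv in xab|exact: xk].
  apply: bigcupT_measurable => k; apply: sub_sigma_algebra.
  by eexists; eexists.
by move=> /(_ measurableT _ mC); rewrite setTI.
Qed.

Lemma measure_row_unique n (m1 m2 : {measure set 'rV[R]_n -> \bar R}) :
  (forall a b, m1 (box a b) = m2 (box a b)) ->
  (forall k, (m1 (cube n k) < +oo)%E) ->
  forall A, measurable A -> m1 A = m2 A.
Proof.
move=> m12 m1oo A mA.
apply: (measure_unique _ (cube n) (measurable_rowE n)) => //.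
- move=> _ _ [a [b ->]] [c [d ->]].
  exists (fun i => Num.max (a i) (c i)), (fun i => Num.min (b i) (d i)).
  apply/seteqP; split=> [x [xab xcd] i|x h].
    have /andP[? ?] := xab i; have /andP[? ?] := xcd i.
    by rewrite gt_max lt_min; apply/andP; split; apply/andP.
  split=> i; have := h i; rewrite gt_max lt_min => /andP[/andP[? ?] /andP[? ?]];
    exact/andP.
- by move=> k; eexists; eexists.
- exact: bigcup_cube.
- by move=> _ [a [b ->]].
Qed.

End boxes.
Arguments cube {R} n k.

Section affine.
Context {R : realType} (n : nat).
Local Notation V := 'rV[R]_n.
Local Notation mu := (@lebesgue_row R n).

Lemma measurable_rowD d (T : measurableType d) (f g : T -> V) :
  measurable_fun setT f -> measurable_fun setT g ->
  measurable_fun setT (fun x => f x + g x).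
Proof.
move=> mf mg; apply: measurable_fun_row => i.
under eq_fun do rewrite mxE.
apply: measurable_funD;
  [exact: (measurableT_comp (measurable_coord i) mf)
  |exact: (measurableT_comp (measurable_coord i) mg)].
Qed.

Lemma measurable_rowZ d (T : measurableType d) (f : T -> R) (g : T -> V) :
  measurable_fun setT f -> measurable_fun setT g ->
  measurable_fun setT (fun x => f x *: g x).
Proof.
move=> mf mg; apply: measurable_fun_row => i.
under eq_fun do rewrite mxE.
apply: measurable_funM => //; exact: (measurableT_comp (measurable_coord i) mg).
Qed.

Lemma measurable_rowB d (T : measurableType d) (f g : T -> V) :
  measurable_fun setT f -> measurable_fun setT g ->
  measurable_fun setT (fun x => f x - g x).
Proof.
move=> mf mg; under eq_fun do rewrite -scaleN1r.
by apply: measurable_rowD => //; exact: measurable_rowZ.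
Qed.

Lemma measurable_affine (c : R) (h : V) :
  measurable_fun setT (fun x : V => c *: x + h).
Proof. by apply: measurable_rowD => //; exact: measurable_rowZ. Qed.

Lemma measurable_translate (h : V) : measurable_fun setT (fun x : V => x + h).
Proof. exact: measurable_rowD. Qed.

(** Both sides are measures in [A], so it suffices to compare them on boxes,
    whose preimages are boxes again. *)
Lemma lebesgue_row_affine (c : R) (h : V) (A : set V) : c != 0 -> measurable A ->
  (mu A = (`|c| ^+ n)%:E * mu ((fun x => c *: x + h)%R @^-1` A))%E.
Proof.
move=> c0 mA.
have cn0 : 0 <= `|c| ^+ n by rewrite exprn_ge0.
pose f : V -> V := fun x => c *: x + h.
pose mf := measurable_affine c h.
pose m2 : {measure set V -> \bar R} :=
  mscale (NngNum cn0) (pushforward mu f).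
rewrite (@measure_row_unique _ _ mu (m2 mf))//; last first.
  by move=> k; rewrite [X in (X < _)%E](@lebesgue_row_box _ n) ltry.
have prodX d : d ^+ n = \prod_(i < n) d :> R by rewrite prodr_const card_ord.
move=> a b; rewrite /m2/= /mscale/= /pushforward.
have [cgt0|] := ltP 0 c; last rewrite le_eqVlt (negbTE c0)/= => clt0.
  have -> : f @^-1` box a b = box (fun i => c^-1 * (a i - h ord0 i))
                                  (fun i => c^-1 * (b i - h ord0 i)).
    apply/seteqP; split=> x xab i; move: (xab i);
    by rewrite !mxE ltr_pdivrMl// ltr_pdivlMl// ltrBlDr ltrBrDr.
  rewrite !lebesgue_row_box -EFinM; congr EFin.
  rewrite gtr0_norm// prodX -big_split/=.
  apply: eq_bigr => i _; rewrite -mulrBr maxr_pMr ?ltW// mulr0 mulrA mulfV//.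
  by rewrite mul1r opprB addrA subrK.
(* for c < 0 the endpoints of each side are exchanged *)
have -> : f @^-1` box a b = box (fun i => c^-1 * (b i - h ord0 i))
                                (fun i => c^-1 * (a i - h ord0 i)).
  apply/seteqP; split=> x xab i; move: (xab i);
  by rewrite !mxE ltr_ndivrMl// ltr_ndivlMl// ltrBlDr ltrBrDr andbC.
rewrite !lebesgue_row_box -EFinM; congr EFin.
rewrite ltr0_norm// prodX -big_split/=.
apply: eq_bigr => i _; rewrite -mulrBr maxr_pMr ?oppr_ge0 ?ltW// mulr0 mulrA.
by rewrite mulNr mulfV// mulN1r opprB opprB addrA subrK.
Qed.

End affine.

(** * L^p norms and the integral inequality of Minkowski *)

Section lnorm_tools.
Context d (T : measurableType d) (R : realType) (m : {measure set T -> \bar R}).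
Local Open Scope ereal_scope.

Lemma ler_poweR (x y : \bar R) (r : R) :
  (0 <= r)%R -> 0 <= x -> x <= y -> x `^ r <= y `^ r.
Proof.
move=> r0 x0 xy; apply: gt0_ler_poweR => //; rewrite in_itv/= ?leey ?andbT//.
exact: le_trans xy.
Qed.

Lemma measurable_abs_poweR (f : T -> \bar R) (r : R) :
  measurable_fun setT f -> measurable_fun setT (fun x => `|f x| `^ r).
Proof.
move=> mf; apply: (@measurableT_comp _ _ _ _ _ _ (fun x => x `^ r)) => //=.
  exact: (measurableT_comp (measurable_poweR _)).
exact: measurableT_comp.
Qed.

Lemma le_Lnorm (p : \bar R) (f g : T -> \bar R) : 1 <= p ->
  measurable_fun setT f -> measurable_fun setT g ->
  {ae m, forall x, `|f x| <= `|g x|} -> 'N[m]_p[f] <= 'N[m]_p[g].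
Proof.
case: p => [p| |]//; rewrite ?lee_fin => p1 mf mg fg; rewrite unlock /Lnorm.
  have p0 : (0 < p)%R by exact: lt_le_trans p1.
  apply: ler_poweR; first by rewrite invr_ge0 ltW.
    by apply: integral_ge0 => x _; exact: poweR_ge0.
  apply: ae_ge0_le_integral => //.
  - by move=> x _; exact: poweR_ge0.
  - exact: measurable_abs_poweR.
  - by move=> x _; exact: poweR_ge0.
  - exact: measurable_abs_poweR.
  - by apply: filterS fg => x fgx _; apply: ler_poweR => //; exact: ltW.
by case: ifPn => // _; exact: le_ess_sup.
Qed.

Lemma Lnorm_le_real (p : R) (f : T -> \bar R) (A : \bar R) : (1 <= p)%R ->
  0 <= A -> ('N[m]_p%:E[f] <= A) <-> (\int[m]_x `|f x| `^ p <= A `^ p).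
Proof.
move=> p1 A0; have p0 : (0 < p)%R by exact: lt_le_trans p1.
rewrite -poweR_Lnorm ?gt_eqF//; split=> h; first exact: ler_poweR (ltW p0) (Lnorm_ge0 _ _ _) h.
have ip0 : (0 <= p^-1)%R by rewrite invr_ge0 ltW.
have := ler_poweR ip0 (poweR_ge0 _ _) h.
by rewrite -!poweRrM mulfV ?gt_eqF// !poweRe1 ?Lnorm_ge0.
Qed.

Lemma Lnorm_le_y (f : T -> \bar R) (A : \bar R) : 0 <= A ->
  {ae m, forall x, `|f x| <= A} -> 'N[m]_+oo[f] <= A.
Proof. by move=> A0 fA; rewrite unlock /Lnorm; case: ifPn => // _; apply/ess_supP. Qed.

Lemma Lnorm_y_ae (f : T -> \bar R) (A : \bar R) : 0 < m setT ->
  'N[m]_+oo[f] <= A -> {ae m, forall x, `|f x| <= A}.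
Proof. by rewrite unlock /Lnorm => -> /ess_supP. Qed.

(** Jensen's inequality for a measure [g m] of mass [M]: Hoelder applied to
    [g = g^(1/p) * g^(1/q)]. Keeping the power of [M] explicit avoids a
    normalisation that would fail for [M = 0]. *)
Lemma jensen_weighted (g f : T -> R) (p M : R) : (1 <= p)%R ->
  measurable_fun setT g -> measurable_fun setT f ->
  (forall x, 0 <= g x)%R -> (forall x, 0 <= f x)%R ->
  \int[m]_x (g x)%:E = M%:E ->
  (\int[m]_x (g x * f x)%:E) `^ p <=
    (M `^ (p - 1))%:E * \int[m]_x (g x * f x `^ p)%:E.
Proof.
move=> + mg mf g0 f0 gM; rewrite le_eqVlt => /predU1P[<-|p1].
  rewrite subrr powRr0 mul1e poweRe1; last first.
    by apply: integral_ge0 => x _; rewrite lee_fin mulr_ge0.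
  by under [leRHS]eq_integral do rewrite powRr1//.
have p0 : (0 < p)%R by exact: lt_trans p1.
have pn0 : p != 0%R by rewrite gt_eqF.
pose q := (p / (p - 1))%R.
have p10 : (p - 1 != 0)%R by rewrite subr_eq0 gt_eqF.
have q0 : (0 < q)%R by rewrite divr_gt0// subr_gt0.
have pq : (p^-1 + q^-1 = 1)%R.
  by rewrite /q invf_div mulrBl mul1r mulfV// addrC subrK.
have mg' r : measurable_fun setT (fun x => g x `^ r)%R.
  exact: (measurableT_comp (measurable_powR r)).
pose F x := (g x `^ p^-1 * f x)%R.
pose G x := (g x `^ q^-1)%R.
have mF : measurable_fun setT F by exact: measurable_funM.
have mG : measurable_fun setT G by exact: mg'.
have := hoelder m mF mG p0 q0 pq.
rewrite Lnorm1.
have -> : \int[m]_x `|(EFin \o (F \* G)%R) x| = \int[m]_x (g x * f x)%:E.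
  apply: eq_integral => x _ /=; rewrite /F /G ger0_norm; last first.
    by rewrite !mulr_ge0// ?powR_ge0.
  rewrite mulrAC -powRD; last by rewrite pq oner_eq0.
  by rewrite pq powRr1.
have I0 : 0 <= \int[m]_x (g x * f x)%:E.
  by apply: integral_ge0 => x _; rewrite lee_fin mulr_ge0.
move=> h; apply: (le_trans (ler_poweR (ltW p0) I0 h)).
rewrite poweRM ?Lnorm_ge0// poweR_Lnorm// muleC.
apply: lee_pmul.
- exact: poweR_ge0.
- by apply: integral_ge0 => x _; exact: poweR_ge0.
- rewrite unlock /=.
  have -> : \int[m]_x (`|g x `^ q^-1| `^ q)%:E = M%:E.
    rewrite -gM; apply: eq_integral => x _; congr EFin.
    by rewrite ger0_norm ?powR_ge0// -powRrM mulVf ?gt_eqF// powRr1.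
  rewrite -poweRrM poweR_EFin.
  by rewrite (_ : (q^-1 * p)%R = (p - 1)%R)// /q invf_div -mulrA mulVf// mulr1.
- rewrite le_eqVlt; apply/orP; left; apply/eqP.
  apply: eq_integral => x _ /=; congr EFin.
  rewrite ger0_norm; last by rewrite mulr_ge0// powR_ge0.
  by rewrite powRM ?powR_ge0// -powRrM mulVf// powRr1.
Qed.

End lnorm_tools.

Section minkowski_integral.
Context d1 d2 (T1 : measurableType d1) (T2 : measurableType d2) (R : realType).
Variables (m1 : {sigma_finite_measure set T1 -> \bar R}).
Variables (m2 : {sigma_finite_measure set T2 -> \bar R}).
Local Open Scope ereal_scope.

(** Minkowski's integral inequality for a uniformly bounded family of slices.
    For finite [p] it is Jensen followed by Tonelli. For [p = +oo] the bound on
    each slice holds outside a null set that depends on the slice; Tonelli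
    exchanges the null sets. *)
Lemma Lnorm_integral_le (g : T2 -> R) (k : T1 * T2 -> R) (p A : \bar R) (M : R) :
  1 <= p -> measurable_fun setT g -> measurable_fun setT k ->
  (forall y, 0 <= g y)%R -> \int[m2]_y (g y)%:E = M%:E -> 0 <= A ->
  (forall y, g y != 0%R -> 'N[m1]_p[(fun x => (k (x, y))%:E)] <= A) ->
  'N[m1]_p[(fun x => \int[m2]_y (g y * `|k (x, y)|)%:E)] <= M%:E * A.
Proof.
move=> p1 mg mk g0 gM A0 kA.
have M0 : (0 <= M)%R.
  by rewrite -lee_fin -gM; apply: integral_ge0 => y _; rewrite lee_fin.
have mk1 x : measurable_fun setT (fun y => k (x, y)).
  exact: measurableT_comp mk (pair1_measurable x).
have mk2 y : measurable_fun setT (fun x => k (x, y)).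
  exact: measurableT_comp mk (pair2_measurable y).
have mg2 : measurable_fun setT (fun z : T1 * T2 => g z.2).
  exact: measurableT_comp mg measurable_snd.
have mgf (f : T1 * T2 -> R) : measurable_fun setT f ->
    measurable_fun setT (fun z => (g z.2 * f z)%:E).
  by move=> mf; apply/measurable_EFinP; exact: measurable_funM.
have mnk : measurable_fun setT (fun z => `|k z|)%R by exact: measurableT_comp.
have mI : measurable_fun setT (fun x => \int[m2]_y (g y * `|k (x, y)|)%:E).
  apply: (measurable_fun_fubini_tonelli_F (m2 := m2)
    (fun z => (g z.2 * `|k z|)%:E)); first exact: mgf.
  by move=> z; rewrite lee_fin mulr_ge0.
have I0 x : 0 <= \int[m2]_y (g y * `|k (x, y)|)%:E.
  by apply: integral_ge0 => y _; rewrite lee_fin mulr_ge0.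
case: p p1 kA => [p| |]//; rewrite ?lee_fin => p1 kA.
  have p0 : (0 < p)%R by exact: lt_le_trans p1.
  apply/Lnorm_le_real => //; first by rewrite mule_ge0// ?lee_fin.
  rewrite poweRM ?lee_fin//.
  have mkp : measurable_fun setT (fun z => `|k z| `^ p)%R.
    exact: (measurableT_comp (measurable_powR p)).
  have Ip0 z : 0 <= (g z.2 * `|k z| `^ p)%:E.
    by rewrite lee_fin mulr_ge0 ?powR_ge0.
  apply: (@le_trans _ _ (\int[m1]_x ((M `^ (p - 1))%:E *
      \int[m2]_y (g y * `|k (x, y)| `^ p)%:E))).
    apply: ge0_le_integral => //.
    - by move=> x _; exact: poweR_ge0.
    - exact: measurable_abs_poweR.
    - apply: measurable_funeM.
      apply: (measurable_fun_fubini_tonelli_F (m2 := m2)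
    (fun z => (g z.2 * `|k z| `^ p)%:E)) => //; exact: mgf.
    - move=> x _; rewrite gee0_abs//; apply: jensen_weighted => //.
      exact: measurableT_comp.
  rewrite ge0_integralZl//; last 3 first.
  - apply: (measurable_fun_fubini_tonelli_F (m2 := m2)
    (fun z => (g z.2 * `|k z| `^ p)%:E)) => //; exact: mgf.
  - by move=> x _; apply: integral_ge0 => y _; exact: (Ip0 (x, y)).
  - by rewrite lee_fin powR_ge0.
  rewrite (fubini_tonelli (m1 := m1) (m2 := m2) (fun z => (g z.2 * `|k z| `^ p)%:E))//; last exact: mgf.
  rewrite poweR_EFin -(mulr_powRB1 M0 p0) mulrC EFinM -muleA.
  apply: lee_pmul => //; first by rewrite lee_fin powR_ge0.
    by apply: integral_ge0 => y _; apply: integral_ge0 => x _; exact: (Ip0 (x, y)).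
  rewrite -gM -ge0_integralZr//; last 3 first.
  - exact/measurable_EFinP.
  - by move=> y _; rewrite lee_fin.
  - exact: poweR_ge0.
  apply: ge0_le_integral => //.
  - by move=> y _; apply: integral_ge0 => x _; exact: (Ip0 (x, y)).
  - apply: (measurable_fun_fubini_tonelli_G (m1 := m1)
    (fun z => (g z.2 * `|k z| `^ p)%:E)) => //; exact: mgf.
  - by apply: emeasurable_funM => //; exact/measurable_EFinP.
  move=> y _.
  have [gy0|gy0] := eqVneq (g y) 0%R.
    rewrite gy0 mul0e; under eq_integral do rewrite mul0r.
    by rewrite integral0.
  under eq_integral => x _ do rewrite /= EFinM.
  rewrite (@ge0_integralZl _ _ _ m1 setT measurableT
    (fun x => (`|k (x, y)| `^ p)%:E))//; last 2 first.
  - by apply/measurable_EFinP; exact: (measurableT_comp mkp (pair2_measurable y)).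
  - by rewrite lee_fin.
  rewrite lee_wpmul2l ?lee_fin//.
  by have /Lnorm_le_real := kA _ gy0; apply.
have [M00|Mn0] := eqVneq M 0%R.
  rewrite M00 mul0e; apply: Lnorm_le_y => //; apply: nearW => x.
  rewrite gee0_abs//.
  have g0ae : {ae m2, forall y, (g y)%:E = 0}.
    have mgE : measurable_fun setT (EFin \o g) by exact/measurable_EFinP.
    have /(ae_eq_integral_abs m2 measurableT mgE) : \int[m2]_y `|(g y)%:E| = 0.
      by under eq_integral do rewrite gee0_abs ?lee_fin//; rewrite gM M00.
    by apply: filterS => y /(_ I).
  rewrite (@ge0_ae_eq_integral _ _ _ m2 setT _ (cst 0))//.
  - by rewrite integral0.
  - by apply/measurable_EFinP; apply: measurable_funM => //; exact: measurableT_comp.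
  - by move=> y _; rewrite lee_fin mulr_ge0.
  - by apply: filterS g0ae => y [->] _; rewrite mul0r.
have {Mn0} Mgt0 : (0 < M)%R by rewrite lt_def Mn0.
case: A A0 kA => [a| |]// a0 kA; last by rewrite gt0_muley ?lte_fin// leey.
have [m10|m10] := leP (m1 setT) 0.
  by rewrite unlock /Lnorm ltNge m10/= -EFinM lee_fin mulr_ge0.
apply: Lnorm_le_y; first by rewrite -EFinM lee_fin mulr_ge0.
(* [e] is the excess over the bound [a]; its weighted double integral is 0 *)
pose e z : R := (Num.max 0 (`|k z| - a))%R.
have me : measurable_fun setT e.
  by apply: measurable_maxr => //; exact: measurable_funB.
have e0 z : (0 <= e z)%R by rewrite le_max lexx.
have mge : measurable_fun setT (fun z => (g z.2 * e z)%:E) by exact: mgf.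
have ge0 z : 0 <= (g z.2 * e z)%:E by rewrite lee_fin mulr_ge0.
have mF := measurable_fun_fubini_tonelli_F (m2 := m2) (fun z => (g z.2 * e z)%:E) mge ge0.
have : \int[m1]_x `|\int[m2]_y (g y * e (x, y))%:E| = 0.
  under eq_integral.
    move=> x _; rewrite gee0_abs; last by apply: integral_ge0 => y _; exact: (ge0 (x, y)).
    over.
  rewrite (fubini_tonelli (m1 := m1) (m2 := m2) (fun z => (g z.2 * e z)%:E))//.
  apply: integral0_eq => y _.
  have [gy0|gy0] := eqVneq (g y) 0%R.
    by apply: integral0_eq => x _; rewrite gy0 mul0r.
  rewrite (@ge0_ae_eq_integral _ _ _ m1 setT _ (cst 0))//.
  - by rewrite integral0.
  - exact: (measurableT_comp mge (pair2_measurable y)).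
  - apply: filterS (Lnorm_y_ae m10 (kA _ gy0)) => x /= + _.
    by rewrite lee_fin => h; rewrite /e max_l ?mulr0// subr_le0.
move/(ae_eq_integral_abs m1 measurableT mF).
apply: filterS => x /(_ I) /= h; rewrite gee0_abs//.
apply: (@le_trans _ _ (\int[m2]_y ((g y * a)%:E + (g y * e (x, y))%:E))).
  apply: ge0_le_integral => //.
  - by move=> y _; rewrite lee_fin mulr_ge0.
  - by apply/measurable_EFinP; apply: measurable_funM => //; exact: measurableT_comp.
  - apply: emeasurable_funD; first by apply/measurable_EFinP; exact: measurable_funM.
    exact: (measurableT_comp mge (pair1_measurable x)).
  - move=> y _; rewrite -EFinD lee_fin -mulrDr ler_wpM2l//.
    by rewrite /e -lerBlDl le_max lexx orbT.
rewrite ge0_integralD//; last 4 first.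
- by move=> y _; rewrite lee_fin mulr_ge0.
- by apply/measurable_EFinP; exact: measurable_funM.
- by move=> y _; exact: (ge0 (x, y)).
- exact: (measurableT_comp mge (pair1_measurable x)).
rewrite [X in _ + X]h adde0; under eq_integral do rewrite EFinM.
rewrite ge0_integralZr//; last 2 first.
- exact/measurable_EFinP.
- by move=> y _; rewrite lee_fin.
by rewrite gM.
Qed.

End minkowski_integral.

(** * Integrals and norms under translation and reflection *)

Section change_of_variables.
Context {R : realType} (n : nat).
Local Notation V := 'rV[R]_n.
Local Notation mu := (@lebesgue_row R n).
Local Open Scope ereal_scope.

Lemma ge0_integral_affine (c : R) (h : V) (f : V -> \bar R) : c != 0%R ->
  measurable_fun setT f -> (forall x, 0 <= f x) ->
  \int[mu]_x f x = (`|c| ^+ n)%:E * \int[mu]_x f (c *: x + h)%R.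
Proof.
move=> c0 mf f0.
have cn0 : (0 <= `|c| ^+ n)%R by rewrite exprn_ge0.
pose phi : V -> V := (fun x => c *: x + h)%R.
have mphi : measurable_fun setT phi by exact: measurable_affine.
pose m2 : {measure set V -> \bar R} := mscale (NngNum cn0) (pushforward mu phi).
transitivity (\int[m2 mphi]_x f x).
  by apply: eq_measure_integral => A mA _; rewrite [LHS](lebesgue_row_affine h c0 mA).
rewrite ge0_integral_mscale//; congr (_ * _).
rewrite ge0_integral_pushforward//.
Qed.

Lemma ge0_integral_translate (h : V) (f : V -> \bar R) :
  measurable_fun setT f -> (forall x, 0 <= f x) ->
  \int[mu]_x f (x + h)%R = \int[mu]_x f x.
Proof.
move=> mf f0; rewrite (ge0_integral_affine h (oner_neq0 R) mf f0).
rewrite normr1 expr1n mul1e; apply: eq_integral => x _.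
by rewrite scale1r.
Qed.

Lemma measurable_reflect (x : V) : measurable_fun setT (fun y : V => x - y)%R.
Proof. exact: measurable_rowB. Qed.

Lemma integral_reflect (x : V) (f : V -> \bar R) : measurable_fun setT f ->
  \int[mu]_y f (x - y)%R = \int[mu]_y f y.
Proof.
move=> mf.
have E (g : V -> \bar R) : measurable_fun setT g -> (forall x, 0 <= g x) ->
    \int[mu]_y g (x - y)%R = \int[mu]_y g y.
  have c0 : (-1 != 0 :> R)%R by rewrite oppr_eq0 oner_eq0.
  move=> mg g0; rewrite [RHS](ge0_integral_affine x c0 mg g0).
  rewrite normrN1 expr1n mul1e; apply: eq_integral => y _.
  by rewrite scaleN1r addrC.
rewrite [LHS]integralE [RHS]integralE; congr (_ - _).
  rewrite -(E f^\+ (measurable_funepos mf) (fun=> funepos_ge0 _ _)).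
  by apply: eq_integral => y _; rewrite !funeposE.
rewrite -(E f^\- (measurable_funeneg mf) (fun=> funeneg_ge0 _ _)).
by apply: eq_integral => y _; rewrite !funenegE.
Qed.

Lemma integral_translate (h : V) (f : V -> \bar R) : measurable_fun setT f ->
  \int[mu]_x f (x + h)%R = \int[mu]_x f x.
Proof.
move=> mf; rewrite [LHS]integralE [RHS]integralE; congr (_ - _).
  rewrite -(ge0_integral_translate h (measurable_funepos mf) (fun=> funepos_ge0 _ _)).
  by apply: eq_integral => y _; rewrite !funeposE.
rewrite -(ge0_integral_translate h (measurable_funeneg mf) (fun=> funeneg_ge0 _ _)).
by apply: eq_integral => y _; rewrite !funenegE.
Qed.

Lemma integrable_translate (h : V) (f : V -> \bar R) :
  mu.-integrable setT f -> mu.-integrable setT (fun x => f (x + h)%R).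
Proof.
move=> /integrableP[mf foo]; apply/integrableP; split.
  exact: measurableT_comp mf (measurable_translate h).
rewrite (ge0_integral_translate h (f := fun x => `|f x|))//.
exact: measurableT_comp.
Qed.

Lemma ae_translate (h : V) (P : V -> Prop) :
  {ae mu, forall x, P x} -> {ae mu, forall x, P (x + h)%R}.
Proof.
move=> [N [mN N0 PN]].
have mh := measurable_affine 1 h.
have E : (fun x : V => x + h)%R = (fun x : V => 1 *: x + h)%R.
  by apply/funext => x; rewrite scale1r.
exists ((fun x => x + h)%R @^-1` N); split.
- by rewrite E -[X in measurable X]setTI; exact: mh.
- have := lebesgue_row_affine h (oner_neq0 R) mN.
  by rewrite -E normr1 expr1n mul1e => <-.
- by move=> x /= Px; exact: PN.
Qed.

Lemma Lnorm_translate (p : \bar R) (h : V) (f : V -> \bar R) : 1 <= p ->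
  measurable_fun setT f ->
  'N[mu]_p[(fun x => f (x + h)%R)] = 'N[mu]_p[f].
Proof.
move=> p1 mf; rewrite unlock /Lnorm; case: p p1 => [p| |]//= p1.
  congr (_ `^ _).
  apply: (ge0_integral_translate h (f := fun x => `|f x| `^ p)) => [|x].
    exact: measurable_abs_poweR.
  exact: poweR_ge0.
case: ifPn => // _; apply/eqP; rewrite eq_le; apply/andP; split.
  apply/ess_supP; apply: (@ae_translate h (fun x => `|f x| <= _)).
  exact: ess_sup_ge.
apply/ess_supP.
have := ess_sup_ge mu (abse \o (fun x => f (x + h)%R)).
move=> /(@ae_translate (- h)%R); apply: filterS => x /=.
by rewrite subrK.
Qed.

Lemma lebesgue_row_gt0 : 0 < mu setT.
Proof.
rewrite lt_neqAle measure_ge0 andbT; apply/eqP => /esym m0.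
have := @lebesgue_row_box R n (fun=> 0%R) (fun=> 1%R).
rewrite [LHS](@subset_measure0 _ _ _ mu _ setT)//; last first.
  exact: measurable_box.
move=> /eqP; rewrite eq_sym subr0 max_r ?ler01// eqe.
by rewrite big1 ?oner_eq0.
Qed.

End change_of_variables.

(** * Sup norm, Euclidean norm and shells *)

Section norms.
Context {R : realType} (n : nat).
Local Notation V := 'rV[R]_n.

Lemma coord_le_norm (x : V) i : `|x ord0 i| <= `|x|.
Proof. by rewrite [leRHS]mx_normrE (le_bigmax _ _ (ord0, i)). Qed.

Lemma norm_row_le (x : V) (c : R) : 0 <= c ->
  (forall i, `|x ord0 i| <= c) -> `|x| <= c.
Proof.
move=> c0 xc; rewrite [leLHS]mx_normrE; apply/bigmax_leP; split=> // -[i j] _ /=.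
by rewrite (ord1 i).
Qed.

Lemma norm_row_lt (x : V) (c : R) : 0 < c ->
  (`|x| < c) <-> (forall i, `|x ord0 i| < c).
Proof.
move=> c0; split=> [xc i|xc].
  by apply: le_lt_trans xc; exact: coord_le_norm.
rewrite [ltLHS]mx_normrE; apply/bigmax_ltP; split=> // -[i j] _ /=.
by rewrite (ord1 i).
Qed.

Lemma norm_le_enorm (x : V) : `|x| <= enorm x.
Proof.
apply: norm_row_le => [|i]; first exact: sqrtr_ge0.
rewrite -sqrtr_sqr ler_sqrt ?sumr_ge0// => [|j _]; last exact: sqr_ge0.
by rewrite (bigD1 i)//= lerDl sumr_ge0// => j _; exact: sqr_ge0.
Qed.

Lemma enorm_le_norm (x : V) : enorm x <= n%:R * `|x|.
Proof.
rewrite -[leRHS]ger0_norm ?mulr_ge0// -[leRHS]sqrtr_sqr ler_sqrt ?sqr_ge0//.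
apply: (@le_trans _ _ (\sum_(i < n) `|x| ^+ 2)).
  apply: ler_sum => i _; rewrite -real_normK ?num_real//.
  by rewrite lerXn2r ?nnegrE// coord_le_norm.
rewrite sumr_const card_ord exprMn -[leLHS]mulr_natl ler_wpM2r ?sqr_ge0//.
by rewrite -natrX ler_nat; case: (n) => // k; rewrite expnS expn1 leq_pmulr.
Qed.

Lemma enorm_ge0 (x : V) : 0 <= enorm x. Proof. exact: sqrtr_ge0. Qed.

Lemma measurable_enorm : measurable_fun setT (@enorm R n).
Proof.
apply: (@measurableT_comp _ _ _ _ _ _ (@Num.sqrt R)).
  by apply: continuous_measurable_fun; exact: sqrt_continuous.
apply: measurable_sum => i; apply: measurable_funX; exact: measurable_coord.
Qed.

Lemma open_ball_box (c : R) : 0 < c ->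
  [set x : V | `|x| < c] = box (fun=> - c) (fun=> c).
Proof.
move=> c0; apply/seteqP; split=> x /=.
  by move=> /(norm_row_lt _ c0) xc i; rewrite -ltr_norml.
by move=> xc; apply/(norm_row_lt _ c0) => i; rewrite ltr_norml; exact: xc.
Qed.

End norms.

Section shells.
Context {R : realType} (n : nat).
Local Notation V := 'rV[R]_n.
Local Notation mu := (@lebesgue_row R n).

(** The ratio 4 leaves room for a cube of side [r] together with its translates
    of step at most [r], see [shell_bound]. *)
Definition shell (r : R) : set V := [set x | r <= `|x| < 4 * r].

Lemma measurable_shell r : 0 < r -> measurable (shell r).
Proof.
move=> r0; have r40 : 0 < 4 * r by rewrite mulr_gt0.
have -> : shell r = [set x : V | `|x| < 4 * r] `\` [set x | `|x| < r].
  apply/seteqP; split=> x /=; first by move=> /andP[rx xr]; split=> //; apply/negP; rewrite -leNgt.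
  by move=> [xr /negP]; rewrite -leNgt => rx; apply/andP.
by rewrite !open_ball_box//; apply: measurableD; exact: measurable_box.
Qed.

Local Open Scope ereal_scope.

(** Radii that grow, or decrease, by a factor 4 give disjoint shells. *)
Lemma sum_shell_le (f : V -> \bar R) (rho : nat -> R) (N : nat) :
  measurable_fun setT f -> (forall x, 0 <= f x) -> (forall k, 0 < rho k)%R ->
  (forall i j, (i < j)%N -> 4 * rho i <= rho j)%R \/
  (forall i j, (i < j)%N -> 4 * rho j <= rho i)%R ->
  \sum_(k < N) \int[mu]_(x in shell (rho k)) f x <= \int[mu]_x f x.
Proof.
move=> mf f0 rho0 sep.
have disj i j x : shell (rho i) x -> shell (rho j) x -> (i < j)%N -> False.
  move=> /andP[ix xi] /andP[jx xj] ij; case: sep => /(_ _ _ ij).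
    by move=> /(lt_le_trans xi) /lt_le_trans /(_ jx); rewrite ltxx.
  by move=> /(lt_le_trans xj) /lt_le_trans /(_ ix); rewrite ltxx.
rewrite -(big_mkord xpredT (fun k => \int[mu]_(x in shell (rho k)) f x)).
rewrite -ge0_integral_bigsetU//.
- apply: ge0_subset_integral => //.
  by apply: bigsetU_measurable => k _; exact: measurable_shell.
- by move=> k; exact: measurable_shell.
- exact: iota_uniq.
- move=> i j _ _ [x [ix jx]]; case: (ltngtP i j) => // ij.
    by case: (disj _ _ _ ix jx ij).
  by case: (disj _ _ _ jx ix ij).
- exact: measurable_funS mf.
Qed.

End shells.

Section geometric_gain.
Context {R : realType}.
Local Open Scope ereal_scope.

(** Letting [N] tend to infinity bounds [a / (1 - 4^-x)], and [1 - 4^-x] is at most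
    [x ln 4 <= 3 x]: a small exponent [x] turns into a small factor. *)
Lemma geometric_gain (a I : \bar R) (D x : R) :
  0 <= a -> 0 <= I -> (0 < D)%R -> (0 < x)%R ->
  (forall N, \sum_(k < N) a * ((4 `^ (- x)) ^+ k)%:E <= D%:E * I) ->
  a <= (D * (3 * x))%:E * I.
Proof.
move=> a0 I0 D0 x0 H.
have [Ioo|] := eqVneq I +oo.
  by rewrite Ioo gt0_muley ?leey// lte_fin !mulr_gt0.
rewrite -ltey => Ioo.
have If : I \is a fin_num by rewrite ge0_fin_numE.
have aoo : a < +oo.
  apply: (le_lt_trans (le_trans _ (H 1%N))).
    by rewrite big_ord1 expr0 mule1.
  by rewrite -(fineK If) -EFinM ltry.
have af : a \is a fin_num by rewrite ge0_fin_numE.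
move: a0 I0 H; rewrite -(fineK If) -(fineK af).
move: (fine a) (fine I) => {af aoo If Ioo I} {}a I.
rewrite -EFinM !lee_fin => a0 I0 H.
set q := (4 `^ (- x))%R in H.
have q0 : (0 < q)%R by rewrite powR_gt0.
have q1 : (q < 1)%R.
  rewrite /q /powR ifF; last by rewrite gt_eqF.
  by rewrite expR_lt1 mulNr oppr_lt0 mulr_gt0// ln_gt0// ltr1n.
have qx : (1 - q <= 3 * x)%R.
  rewrite lerBlDr -lerBlDl.
  rewrite /q /powR ifF; last by rewrite gt_eqF.
  apply: le_trans (expR_ge1Dx _); rewrite lerD2l mulNr lerN2 mulrC.
  rewrite ler_wpM2r ?(ltW x0)//.
  have := @le_ln1Dx R 3; rewrite (_ : (1 + 3 = 4)%R); last by ring.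
  by apply; lra.
have H' N : (a * (1 - q ^+ N) <= (1 - q) * (D * I))%R.
  have := H N; under eq_bigr do rewrite -EFinM.
  rewrite sumEFin lee_fin -mulr_sumr => {}H.
  have -> : (1 - q ^+ N = (1 - q) * \sum_(i < N) q ^+ i)%R.
    by rewrite -opprB subrX1 -mulNr opprB.
  by rewrite mulrCA ler_wpM2l// subr_ge0 ltW.
have : (a <= (1 - q) * (D * I))%R.
  have cv : (a * (1 - q ^+ N))%R @[N --> \oo] --> (a * (1 - 0))%R.
    apply: cvgMr; apply: cvgB; first exact: cvg_cst.
    by apply: cvg_expr; rewrite gtr0_norm.
  rewrite -[X in (X <= _)%R]mulr1 -[X in (_ * X <= _)%R]subr0 -(cvg_lim _ cv)//.
  by apply: limr_le; [exact: (cvgP _ cv)|exact: nearW].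
move/le_trans; apply.
rewrite (_ : (D * (3 * x) * I = 3 * x * (D * I))%R); last by ring.
by rewrite ler_wpM2r// mulr_ge0// ltW.
Qed.

End geometric_gain.

(** * Pointwise bounds from a Gagliardo integral *)

Section gagliardo_gain.
Context {R : realType} (n : nat) (hn : (0 < n)%N).
Local Notation V := 'rV[R]_n.
Local Notation mu := (@lebesgue_row R n).
Local Open Scope ereal_scope.

Lemma poweRD_le (a b : \bar R) (p : R) : (0 <= p)%R -> 0 <= a -> 0 <= b ->
  (a + b) `^ p <= (2 `^ p)%:E * (a `^ p + b `^ p).
Proof.
move=> p0; wlog ab : a b / a <= b.
  move=> H a0 b0; have [|/ltW] := leP a b => ab; first exact: H.
  by rewrite addeC [X in _ * X]addeC; exact: H.
move=> a0 b0; apply: (@le_trans _ _ ((2%:E * b) `^ p)).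
  by apply: ler_poweR; rewrite ?adde_ge0// mule_natl mule2n leeD2r.
rewrite poweRM ?lee_fin// poweR_EFin lee_wpmul2l ?lee_fin ?powR_ge0//.
by rewrite leeDr// poweR_ge0.
Qed.

Variables (s p : R).
Hypotheses (s01 : (0 < s < 1)%R) (p1 : (1 <= p)%R).

Let p0 : (0 < p)%R. Proof. exact: lt_le_trans p1. Qed.
Let s0 : (0 < s)%R. Proof. by case/andP: s01. Qed.
Let s1 : (s < 1)%R. Proof. by case/andP: s01. Qed.

Definition gkernel (y : V) : R := ((enorm y `^ (n%:R + s * p))^-1)%R.

Lemma measurable_gkernel : measurable_fun setT gkernel.
Proof.
rewrite /gkernel; under eq_fun do rewrite -powRN.
apply: (@measurableT_comp _ _ _ _ _ _ (fun t : R => t `^ - (n%:R + s * p))%R).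
  exact: measurable_powR.
exact: measurable_enorm.
Qed.

Lemma gkernel_ge0 y : (0 <= gkernel y)%R.
Proof. by rewrite invr_ge0 powR_ge0. Qed.

(** Large enough for [shellCP]: its p-th power absorbs the factor
    [2^p * 2 * (4 n)^(n + s p)] of the one-shell estimate, uniformly in [s] and
    [p]. *)
Definition shellC : R := (4 * (4 * n%:R) ^+ n.+1)%R.

Let m1n : (1 <= n%:R :> R)%R. Proof. by rewrite ler1n. Qed.

Lemma shellC_ge1 : (1 <= shellC)%R.
Proof.
rewrite /shellC -[X in (X <= _)%R]mulr1 ler_pM// ?ler1n//.
by rewrite exprn_ege1// -[X in (X <= _)%R]mulr1 ler_pM// ler1n.
Qed.

Lemma shellCP (r : R) : (0 < r)%R ->
  (2 `^ p * (2 * (4 * n%:R * r) `^ (n%:R + s * p)) <=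
    shellC `^ p * r `^ (s * p) * r ^+ n)%R.
Proof.
move=> r0; have a0 : (0 <= 4 * n%:R :> R)%R by rewrite mulr_ge0.
have a1 : (1 <= 4 * n%:R :> R)%R by rewrite -[X in (X <= _)%R]mulr1 ler_pM// ler1n.
rewrite powRM ?(ltW r0)// [X in (_ * (_ * (_ * X)) <= _)%R]powRD; last first.
  by rewrite (gt_eqF r0) implybT.
rewrite powR_mulrn ?(ltW r0)//.
rewrite [X in (_ <= X)%R](_ : _ = shellC `^ p * (r ^+ n * r `^ (s * p)))%R; last by ring.
have e1 : (2 `^ p * 2 <= 4 `^ p :> R)%R.
  have -> : (4 = 2 * 2 :> R)%R by rewrite -natrM.
  by rewrite powRM// ler_wpM2l ?powR_ge0// le1r_powR// ler1n.
have e2 : ((4 * n%:R) `^ (n%:R + s * p) <= ((4 * n%:R) ^+ n.+1) `^ p :> R)%R.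
  rewrite -powR_mulrn// -powRrM ler_powR//.
  rewrite -natr1 mulrDl mul1r lerD//.
    by rewrite ler_peMr// (le_trans _ m1n).
  by rewrite -[leRHS]mul1r ler_wpM2r ?(ltW p0)// ltW.
rewrite [leLHS](_ : _ = (2 `^ p * 2) * (4 * n%:R) `^ (n%:R + s * p) *
  (r ^+ n * r `^ (s * p)))%R; last by ring.
rewrite ler_wpM2r ?mulr_ge0 ?powR_ge0 ?exprn_ge0 ?(ltW r0)//.
by rewrite /shellC [leRHS]powRM ?exprn_ge0// ler_pM ?mulr_ge0 ?powR_ge0.
Qed.

Variable w : V -> \bar R.
Hypotheses (w0 : forall x : V, 0 <= w x) (mw : measurable_fun setT w).
Hypotheses (wD : forall x y : V, w (x + y)%R <= w x + w y).
Hypotheses (wN : forall x : V, w (- x)%R = w x).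

Let F y := w y `^ p * (gkernel y)%:E.

Let F0 y : 0 <= F y.
Proof. by rewrite mule_ge0 ?poweR_ge0// lee_fin gkernel_ge0. Qed.

Let mwp : measurable_fun setT (fun y => w y `^ p).
Proof. exact: (measurableT_comp (measurable_poweR p)). Qed.

Let mF : measurable_fun setT F.
Proof.
apply: emeasurable_funM => //; apply/measurable_EFinP; exact: measurable_gkernel.
Qed.

(** Subadditivity gives [w h <= w y + w (y - h)]. Average this over a cube [S] of
    volume [r^n] such that [y] and [y - h] both stay in the shell, on which the
    weight [gkernel] is bounded below. *)
Lemma shell_bound (r : R) (h : V) : (0 < r)%R -> (`|h| <= r)%R ->
  w h `^ p <= (shellC `^ p * r `^ (s * p))%:E * \int[mu]_(y in shell r) F y.
Proof.
move=> r0 hr.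
(* at distance at least r from both ends of the shell *)
pose S : set V := box (fun=> 2 * r)%R (fun=> 3 * r)%R.
have mS : measurable S by exact: measurable_box.
have muS : mu S = (r ^+ n)%:E.
  rewrite [LHS]lebesgue_row_box; congr EFin.
  rewrite (_ : 3 * r - 2 * r = r)%R; last by ring.
  by rewrite max_r ?ltW// prodr_const card_ord.
have mT := measurable_shell (n := n) r0.
have mwt : measurable_fun setT (fun y : V => w (y - h)%R `^ p).
  exact: (measurableT_comp mwp (measurable_translate (- h)%R)).
have rn0 : (0 < r ^+ n)%R by rewrite exprn_gt0.
have ST : S `<=` shell r.
  move=> y yS; rewrite /shell/=; apply/andP; split.
    have := yS (Ordinal hn) => /andP[+ _] => h1.
    apply: (le_trans _ (coord_le_norm y (Ordinal hn))).
    apply: (le_trans _ (ler_norm _)); lra.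
  apply/norm_row_lt; first by rewrite mulr_gt0.
  move=> i; have /andP[h1 h2] := yS i; rewrite gtr0_norm; lra.
have ST' y : S (y + h)%R -> shell r y.
  move=> yS; rewrite /shell/=; apply/andP; split.
    have := yS (Ordinal hn); rewrite mxE => /andP[+ _] => h1.
    apply: (le_trans _ (coord_le_norm y (Ordinal hn))).
    apply: (le_trans _ (ler_norm _)).
    have := le_trans (ler_norm _) (le_trans (coord_le_norm h (Ordinal hn)) hr); lra.
  apply/norm_row_lt; first by rewrite mulr_gt0.
  move=> i; have /andP := yS i; rewrite mxE => -[h1 h2].
  have := le_trans (coord_le_norm h i) hr; rewrite ler_norml => /andP[? ?].
  by rewrite ltr_norml; apply/andP; split; lra.
rewrite -(@lee_pmul2r _ (r ^+ n)%:E)//.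
apply: (@le_trans _ _ (\int[mu]_(y in S) ((2 `^ p)%:E * (w y `^ p + w (y - h)%R `^ p)))).
  rewrite -muS -integral_cst//; apply: ge0_le_integral => //.
  - by move=> y _; exact: poweR_ge0.
  - apply: measurable_funTS; apply: measurable_funeM.
    exact: emeasurable_funD.
  - move=> y _; apply: le_trans (poweRD_le _ _ _) => //; last exact: ltW.
    apply: ler_poweR => //; first exact: ltW.
    apply: (@le_trans _ _ (w y + w (h - y)%R)).
      by apply: le_trans (wD _ _); rewrite addrC subrK.
    by rewrite -(wN (y - h)%R) opprB.
have wp0 y : 0 <= w y `^ p by exact: poweR_ge0.
rewrite ge0_integralZl//; last 2 first.
- by apply: measurable_funTS; exact: emeasurable_funD.
- by move=> y _; exact: adde_ge0.
rewrite ge0_integralD//; last 2 first.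
- exact: measurable_funTS.
- exact: measurable_funTS.
set J := \int[mu]_(y in shell r) (w y `^ p).
have J1 : \int[mu]_(y in S) (w y `^ p) <= J.
  by apply: ge0_subset_integral => //; exact: measurable_funTS.
have J2 : \int[mu]_(y in S) (w (y - h)%R `^ p) <= J.
  rewrite integral_mkcond -(ge0_integral_translate h)//; last 2 first.
  - by apply/(measurable_restrictT _ _).1 => //; exact: measurable_funTS.
  - by move=> y; apply: erestrict_ge0 => *; exact: poweR_ge0.
  rewrite /J [leRHS]integral_mkcond; apply: ge0_le_integral => //.
  - by move=> y _; apply: erestrict_ge0 => *; exact: poweR_ge0.
  - apply: (measurableT_comp _ (measurable_translate h)).
    by apply/(measurable_restrictT _ _).1 => //; exact: measurable_funTS.
  - by apply/(measurable_restrictT _ _).1 => //; exact: measurable_funTS.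
  - move=> y _; rewrite !patchE addrK; case: ifPn => [|_]; last first.
      by case: ifPn => // _; exact: poweR_ge0.
    by rewrite inE => /ST' yT; rewrite ifT// inE.
have J3 : J <= ((4 * n%:R * r) `^ (n%:R + s * p))%:E * \int[mu]_(y in shell r) F y.
  rewrite -ge0_integralZl//; last 2 first.
  - exact: measurable_funTS.
  - by rewrite lee_fin powR_ge0.
  apply: ge0_le_integral => //.
  - exact: measurable_funTS.
  - by apply: measurable_funTS; exact: measurable_funeM.
  - move=> y /andP[ry yr]; rewrite /F muleCA -[leLHS]mule1.
    apply: lee_wpmul2l => //; rewrite -EFinM lee_fin /gkernel.
    have ey : (0 < enorm y)%R.
      by apply: lt_le_trans (norm_le_enorm y); exact: lt_le_trans ry.
    have eyr : (enorm y <= 4 * n%:R * r)%R.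
      apply: le_trans (enorm_le_norm y) _.
      rewrite [leRHS](_ : _ = n%:R * (4 * r))%R; last by ring.
      by rewrite ler_wpM2l// ltW.
    rewrite ler_pdivlMr ?powR_gt0// mul1r.
    apply: ge0_ler_powR => //; rewrite ?nnegrE ?(ltW ey)//.
      by rewrite ltW// addr_gt0 ?ltr0n// mulr_gt0.
    exact: le_trans (ltW ey) eyr.
apply: (@le_trans _ _ ((2 `^ p)%:E * (2%:E * J))).
  rewrite lee_wpmul2l ?lee_fin ?powR_ge0//.
  by rewrite mule_natl mule2n leeD.
apply: (@le_trans _ _ ((2 `^ p)%:E * (2%:E *
    (((4 * n%:R * r) `^ (n%:R + s * p))%:E * \int[mu]_(y in shell r) F y)))).
  by rewrite !lee_wpmul2l ?lee_fin ?powR_ge0.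
rewrite !muleA -!EFinM -muleA [X in _ <= _ * X]muleC muleA -EFinM.
rewrite lee_wpmul2r ?integral_ge0// lee_fin -mulrA.
exact: shellCP.
Qed.

Lemma w_dilate (k : nat) (x : V) : w ((4 ^+ k) *: x)%R <= (4 ^+ k)%:E * w x.
Proof.
have w2 y : w (2 *: y)%R <= 2%:E * w y.
  rewrite scaler_nat mulr2n mule_natl mule2n; exact: wD.
have w4 y : w (4 *: y)%R <= 4%:E * w y.
  have -> : (4 = 2 * 2 :> R)%R by rewrite -natrM.
  rewrite -scalerA EFinM -muleA; apply: le_trans (w2 _) _.
  by rewrite lee_wpmul2l// lee_fin.
elim: k x => [|k IH] x; first by rewrite expr0 scale1r mul1e.
rewrite exprS -scalerA EFinM -muleA; apply: le_trans (w4 _) _.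
by rewrite lee_wpmul2l// lee_fin.
Qed.

(** [geometric_gain] produces a factor [3 p t] with [t <= 2 s (1 - s)], and
    [6 p <= (6 e)^p] absorbs it into a p-th power, see [gainCP]. *)
Definition gainC : R := (6 * expR 1 * shellC)%R.

Lemma gainC_gt0 : (0 < gainC)%R.
Proof.
apply: mulr_gt0; first by rewrite mulr_gt0 ?expR_gt0.
exact: lt_le_trans shellC_ge1.
Qed.

Lemma gainC_ge_dim : (n%:R <= gainC :> R)%R.
Proof.
have a1 : (1 <= 4 * n%:R :> R)%R by rewrite -[X in (X <= _)%R]mulr1 ler_pM// ler1n.
have e1 : (1 <= expR 1 :> R)%R.
  by apply: le_trans (expR_ge1Dx _); rewrite lerDl.
apply: (@le_trans _ _ (1 * ((4 * n%:R) ^+ n.+1))%R).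
  rewrite mul1r; apply: (@le_trans _ _ (4 * n%:R)%R).
    by rewrite ler_peMl// ler1n.
  exact: ler_eXnr.
rewrite /gainC /shellC mulrA ler_wpM2r ?exprn_ge0 ?mulr_ge0//; lra.
Qed.

Lemma gainC_ge2 : (2 <= gainC)%R.
Proof.
have e1 : (1 <= expR 1 :> R)%R.
  by apply: le_trans (expR_ge1Dx _); rewrite lerDl.
have := shellC_ge1; rewrite /gainC => h.
apply: (@le_trans _ _ (6 * 1 * 1)%R); first lra.
by rewrite ler_pM// ler_pM.
Qed.

Lemma gainCP (r t : R) : (0 < r)%R -> (0 < t)%R -> (t <= 2 * (s * (1 - s)))%R ->
  (shellC `^ p * r `^ (s * p) * (3 * (t * p)) <=
   (gainC * r `^ s) `^ p * (s * (1 - s)))%R.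
Proof.
move=> r0 t0 ts; have sC0 : (0 <= shellC)%R by apply: le_trans shellC_ge1.
have e0 : (0 <= 6 * expR 1 :> R)%R by rewrite mulr_ge0 ?expR_ge0.
rewrite powRM ?mulr_ge0 ?powR_ge0// /gainC powRM//.
rewrite [X in (_ <= X)%R](_ : _ = (shellC `^ p * r `^ (s * p)) *
  ((6 * expR 1) `^ p * (s * (1 - s))))%R; last by rewrite powRrM; ring.
rewrite ler_wpM2l ?mulr_ge0 ?powR_ge0//.
have q1 : (6 * p <= (6 * expR 1) `^ p)%R.
  rewrite powRM ?expR_ge0// ler_pM ?(ltW p0)//.
    by rewrite le1r_powR// ler1n.
  rewrite /powR ifF ?expRK; last by rewrite gt_eqF ?expR_gt0.
  by rewrite mulr1; apply: le_trans (expR_ge1Dx _); rewrite lerDr.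
apply: (@le_trans _ _ (6 * p * (s * (1 - s)))%R).
  rewrite [leLHS](_ : _ = 3 * p * t)%R; last by ring.
  rewrite [leRHS](_ : _ = 3 * p * (2 * (s * (1 - s))))%R; last by ring.
  by rewrite ler_wpM2l// mulr_ge0// ltW.
by rewrite ler_wpM2r// mulr_ge0 ?subr_ge0 ?ltW.
Qed.

(** The factor [s (1 - s)] comes from a geometric series of shells. For
    [s <= 1/2], [h] is compared with the shells of radius [4^k r >= r], which
    gives terms of ratio [4^(-s p)]. For [s > 1/2], [w h <= 4^k w (4^-k h)]
    is compared with the shells of radius [4^-k r], which gives terms of ratio
    [4^(-(1 - s) p)]. By [geometric_gain] the sums yield a factor proportional
    to [s], respectively [1 - s]. *)
Lemma gagliardo_gain (r : R) (h : V) : (0 < r)%R -> (`|h| <= r)%R ->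
  w h `^ p <= ((gainC * r `^ s) `^ p * (s * (1 - s)))%:E * \int[mu]_y F y.
Proof.
move=> r0 hr.
have I0 : 0 <= \int[mu]_y F y by exact: integral_ge0.
have D0 : (0 < shellC `^ p * r `^ (s * p))%R.
  by rewrite mulr_gt0// powR_gt0// (lt_le_trans _ shellC_ge1).
have four a k : ((4 `^ a) ^+ k = 4 `^ (a * k%:R) :> R)%R.
  by rewrite -powR_mulrn ?powR_ge0// powRrM.
have fourX k : (4 ^+ k = 4 `^ k%:R :> R)%R by rewrite powR_mulrn.
suff [t [t0 ts]] : exists t, [/\ (0 < t)%R, (t <= 2 * (s * (1 - s)))%R &
    forall N, \sum_(k < N) w h `^ p * ((4 `^ (- (t * p))) ^+ k)%:E <=
      (shellC `^ p * r `^ (s * p))%:E * \int[mu]_y F y].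
  move=> /(geometric_gain (poweR_ge0 _ _) I0 D0 (mulr_gt0 t0 p0)) /le_trans; apply.
  by apply: lee_wpmul2r => //; rewrite lee_fin; exact: gainCP.
have [s2|s2] := leP s (2^-1)%R.
  (* large shells *)
  exists s; split=> //; first by rewrite mulrCA ler_peMr ?(ltW s0)//; lra.
  move=> N; pose rho k := (4 ^+ k * r)%R.
  have rho0 k : (0 < rho k)%R by rewrite mulr_gt0// exprn_gt0.
  apply: (@le_trans _ _ ((shellC `^ p * r `^ (s * p))%:E *
      \sum_(k < N) \int[mu]_(y in shell (rho k)) F y)); last first.
    rewrite lee_wpmul2l ?lee_fin ?(ltW D0)//; apply: sum_shell_le => //.
    left => i j ij; rewrite /rho mulrA -exprS ler_wpM2r ?(ltW r0)//.
    by rewrite ler_weXn2l// ler1n.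
  rewrite ge0_sume_distrr; last by move=> *; exact: integral_ge0.
  apply: lee_sum => k _.
  have hk : (`|h| <= rho k)%R.
    by apply: le_trans hr _; rewrite ler_peMl ?(ltW r0)// exprn_ege1// ler1n.
  apply: le_trans (lee_wpmul2r _ (shell_bound (rho0 k) hk)) _.
    by rewrite lee_fin exprn_ge0// powR_ge0.
  rewrite muleAC -EFinM le_eqVlt; apply/orP; left; apply/eqP; congr (_%:E * _).
  rewrite -mulrA; congr (_ * _)%R; rewrite /rho powRM ?exprn_ge0 ?(ltW r0)//.
  rewrite fourX -powRrM four mulrAC -powRD; last by rewrite pnatr_eq0 implybT.
  by rewrite (_ : _ + _ = 0)%R ?powRr0 ?mul1r//; ring.
(* small shells *)
exists (1 - s)%R; split; [by rewrite subr_gt0|by rewrite mulrA ler_peMl ?subr_ge0 ?(ltW s1)//; lra|].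
move=> N; pose rho k := ((4 ^+ k)^-1 * r)%R.
have rho0 k : (0 < rho k)%R by rewrite mulr_gt0// invr_gt0 exprn_gt0.
apply: (@le_trans _ _ ((shellC `^ p * r `^ (s * p))%:E *
    \sum_(k < N) \int[mu]_(y in shell (rho k)) F y)); last first.
  rewrite lee_wpmul2l ?lee_fin ?(ltW D0)//; apply: sum_shell_le => //.
  right => i j ij; rewrite /rho mulrA ler_wpM2r ?(ltW r0)//.
  rewrite ler_pdivrMr ?exprn_gt0// mulrC ler_pdivlMr ?exprn_gt0//.
  by rewrite -exprS ler_weXn2l// ler1n.
rewrite ge0_sume_distrr; last by move=> *; exact: integral_ge0.
apply: lee_sum => k _.
pose h' : V := ((4 ^+ k)^-1 *: h)%R.
have hk : (`|h'| <= rho k)%R.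
  rewrite /h' normrZ ger0_norm ?invr_ge0 ?exprn_ge0//.
  by rewrite ler_wpM2l// invr_ge0 exprn_ge0.
have wh : w h <= (4 ^+ k)%:E * w h'.
  apply: le_trans (w_dilate k h'); rewrite /h' scalerA mulfV ?scale1r//.
have {}wh : w h `^ p <= ((4 ^+ k) `^ p)%:E * w h' `^ p.
  rewrite -poweR_EFin -poweRM ?lee_fin ?exprn_ge0//.
  by apply: ler_poweR => //; exact: ltW.
apply: le_trans (lee_wpmul2r _ wh) _.
  by rewrite lee_fin exprn_ge0// powR_ge0.
apply: le_trans (lee_wpmul2r _ (lee_wpmul2l _ (shell_bound (rho0 k) hk))) _.
- by rewrite lee_fin exprn_ge0// powR_ge0.
- by rewrite lee_fin powR_ge0.
rewrite muleA muleAC -!EFinM le_eqVlt; apply/orP; left; apply/eqP; congr (_%:E * _).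
have -> : (rho k `^ (s * p) = 4 `^ (- k%:R * (s * p)) * r `^ (s * p))%R.
  by rewrite /rho powRM ?invr_ge0 ?exprn_ge0 ?(ltW r0)// -powR_invn// -powRrM.
rewrite fourX -powRrM four.
have E : (4 `^ (k%:R * p) * 4 `^ (- k%:R * (s * p)) * 4 `^ (- ((1 - s) * p) * k%:R)
    = 1 :> R)%R.
  rewrite -!powRD ?pnatr_eq0 ?implybT//.
  by rewrite (_ : _ + _ = 0)%R ?powRr0//; ring.
set a := (4 `^ (k%:R * p))%R in E *.
set b := (4 `^ (- k%:R * (s * p)))%R in E *.
set c := (4 `^ (- ((1 - s) * p) * k%:R))%R in E *.
set X := (shellC `^ p)%R; set Y := (r `^ (s * p))%R.
rewrite (_ : a * (X * (b * Y)) * c = a * b * c * (X * Y))%R; last by ring.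
by rewrite E mul1r.
Qed.

End gagliardo_gain.

(** * Translation differences and the Gagliardo seminorm *)

Section translation_difference.
Context {R : realType} (n : nat).
Local Notation V := 'rV[R]_n.
Local Notation mu := (@lebesgue_row R n).
Implicit Types (u : V -> R) (h k : V) (p : \bar R).

Definition shift_diff h u : V -> R := fun x => u (x + h) - u x.

Lemma measurable_shift_diff h u : measurable_fun setT u ->
  measurable_fun setT (shift_diff h u).
Proof.
move=> mu_; apply: measurable_funB => //.
exact: measurableT_comp mu_ (measurable_translate h).
Qed.

Lemma measurable_shift_diff2 u : measurable_fun setT u ->
  measurable_fun setT (fun z : V * V => shift_diff z.2 u z.1).
Proof.
move=> mu_; apply: measurable_funB; last exact: measurableT_comp mu_ measurable_fst.
exact: measurableT_comp mu_ (measurable_rowD measurable_fst measurable_snd).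
Qed.

Local Open Scope ereal_scope.

Lemma Lnorm_shift_diffD p h k u : 1 <= p -> measurable_fun setT u ->
  'N[mu]_p[EFin \o shift_diff (h + k)%R u] <=
  'N[mu]_p[EFin \o shift_diff h u] + 'N[mu]_p[EFin \o shift_diff k u].
Proof.
move=> p1 mu_.
have mh := measurable_shift_diff h mu_; have mk := measurable_shift_diff k mu_.
have mhk : measurable_fun setT (fun x : V => shift_diff h u (x + k)%R).
  exact: measurableT_comp mh (measurable_translate k).
rewrite (_ : shift_diff (h + k)%R u =
    ((fun x => shift_diff h u (x + k)%R) \+ shift_diff k u)%R); last first.
  apply/funext => x /=; rewrite /shift_diff (addrC h) addrA addrA.
  by rewrite subrK.
apply: le_trans (eminkowski _ _ _ _) _ => //.
rewrite (_ : EFin \o _ = (fun x => (EFin \o shift_diff h u) (x + k)%R)) //.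
by rewrite (Lnorm_translate k)//; exact/measurable_EFinP.
Qed.

Lemma Lnorm_shift_diffN p h u : 1 <= p -> measurable_fun setT u ->
  'N[mu]_p[EFin \o shift_diff (- h)%R u] = 'N[mu]_p[EFin \o shift_diff h u].
Proof.
move=> p1 mu_; have mh := measurable_shift_diff h mu_.
rewrite -[RHS](Lnorm_translate (- h)%R) //; last exact/measurable_EFinP.
rewrite -[RHS]oppe_Lnorm; apply: eq_Lnorm => x /=.
by rewrite /shift_diff subrK opprB.
Qed.

Lemma Lnorm_shift_diff_le2 p h u : 1 <= p -> measurable_fun setT u ->
  'N[mu]_p[EFin \o shift_diff h u] <= 2%:E * 'N[mu]_p[EFin \o u].
Proof.
move=> p1 mu_.
have muh : measurable_fun setT (fun x : V => u (x + h)%R).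
  exact: measurableT_comp mu_ (measurable_translate h).
rewrite mule_natl mule2n.
rewrite -[X in _ <= X + _](Lnorm_translate h)//; last exact/measurable_EFinP.
rewrite -[X in _ <= _ + X]oppe_Lnorm.
apply: (eminkowski mu muh (g := (\- u)%R)) => //.
exact: measurable_funN.
Qed.

Lemma measurable_Lnorm_shift_diff (p : R) u : measurable_fun setT u ->
  measurable_fun setT (fun h => 'N[mu]_p%:E[EFin \o shift_diff h u]).
Proof.
move=> mu_; rewrite unlock /Lnorm.
apply: (@measurableT_comp _ _ _ _ _ _ (fun x => x `^ p^-1)) => //.
  exact: measurable_poweR.
apply: (measurable_fun_fubini_tonelli_G (m1 := mu)
  (fun z : V * V => `|(shift_diff z.2 u z.1)%:E| `^ p)).
  by apply: measurable_abs_poweR; apply/measurable_EFinP; exact: measurable_shift_diff2.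
by move=> z; exact: poweR_ge0.
Qed.

(** Substitute [x = y + h] and exchange the integrals: the double integral is
    an integral over the step [h], to which [gagliardo_gain] applies. *)
Lemma gagliardo_shift_diff (s p : R) u : (1 <= p)%R -> measurable_fun setT u ->
  \int[mu]_y \int[mu]_x
       (`|u x - u y| `^ p / enorm (x - y) `^ (n%:R + s * p))%:E =
  \int[mu]_h ('N[mu]_p%:E[EFin \o shift_diff h u] `^ p * (gkernel s p h)%:E).
Proof.
move=> p1 mu_; have pn0 : p != 0%R by rewrite gt_eqF// (lt_le_trans _ p1).
have mk : measurable_fun setT (@gkernel R n s p) by exact: measurable_gkernel.
pose G (z : V * V) := (`|shift_diff z.2 u z.1| `^ p * gkernel s p z.2)%:E.
have mG : measurable_fun setT G.
  apply/measurable_EFinP; apply: measurable_funM.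
    apply: (measurableT_comp (measurable_powR p)).
    apply: measurableT_comp => //; exact: measurable_shift_diff2.
  exact: measurableT_comp mk measurable_snd.
have G0 z : 0 <= G z by rewrite lee_fin mulr_ge0 ?powR_ge0 ?gkernel_ge0.
transitivity (\int[mu]_y \int[mu]_h G (y, h)).
  apply: eq_integral => y _.
  rewrite -(ge0_integral_translate y).
  - by apply: eq_integral => h _; rewrite /G /gkernel/= /shift_diff addrK (addrC h).
  - apply/measurable_EFinP; apply: measurable_funM.
      apply: (measurableT_comp (measurable_powR p)).
      by apply: measurableT_comp => //; exact: measurable_funB.
    exact: measurableT_comp mk (measurable_translate (- y)%R).
  - by move=> x; rewrite lee_fin mulr_ge0 ?powR_ge0// invr_ge0 powR_ge0.
rewrite (fubini_tonelli (m1 := mu) (m2 := mu) G)//.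
apply: eq_integral => h _; rewrite poweR_Lnorm//.
rewrite -ge0_integralZr//; last 3 first.
- apply: measurable_abs_poweR; apply/measurable_EFinP; exact: measurable_shift_diff.
- by move=> x _; exact: poweR_ge0.
- by rewrite lee_fin gkernel_ge0.
Qed.

Lemma Lnorm_shift_diff_gagliardo (s p : R) (r : R) h u : (0 < n)%N ->
  (0 < s < 1)%R -> (1 <= p)%R -> measurable_fun setT u ->
  (0 < r)%R -> (`|h| <= r)%R ->
  'N[mu]_p%:E[EFin \o shift_diff h u] <=
  (gainC n * r `^ s)%:E * gagliardo s p%:E u.
Proof.
move=> hn s01 p1 mu_ r0 hr; have /andP[s0 s1] := s01.
have p0 : (0 < p)%R by exact: lt_le_trans p1.
have pn0 : p != 0%R by rewrite gt_eqF.
have p1' : 1 <= p%:E by [].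
pose w h := 'N[mu]_p%:E[EFin \o shift_diff h u].
have := @gagliardo_gain _ n hn s p s01 p1 w (fun h => Lnorm_ge0 _ _ _)
  (measurable_Lnorm_shift_diff p mu_)
  (fun h k => Lnorm_shift_diffD h k p1' mu_)
  (fun h => Lnorm_shift_diffN h p1' mu_) r h r0 hr.
have C0 := gainC_gt0 (R := R) hn.
set I := \int[mu]_y _ => H.
have I0 : 0 <= I.
  by apply: integral_ge0 => y _; rewrite mule_ge0 ?poweR_ge0// lee_fin gkernel_ge0.
have CD : (0 <= gainC n * r `^ s)%R by rewrite mulr_ge0 ?powR_ge0// ltW.
have pV0 : (0 <= p^-1)%R by rewrite invr_ge0 ltW.
have := ler_poweR pV0 (poweR_ge0 _ _) H.
rewrite -poweRrM mulfV// poweRe1 ?Lnorm_ge0// => /le_trans; apply.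
rewrite EFinM -muleA poweRM ?lee_fin ?powR_ge0 ?mule_ge0 ?lee_fin ?mulr_ge0 ?subr_ge0 ?(ltW s0) ?(ltW s1)//.
rewrite -poweR_EFin -poweRrM mulfV// poweRe1 ?lee_fin//.
by rewrite /gagliardo gagliardo_shift_diff.
Qed.

End translation_difference.

(** * The Hoelder seminorm up to null sets *)

Section lipschitz_endpoint.
Context {R : realType} (n : nat).
Local Notation V := 'rV[R]_n.
Local Notation mu := (@lebesgue_row R n).
Implicit Types (u : V -> R) (h k : V).
Local Open Scope ereal_scope.

Lemma ae_exists_small (r : R) (P : V -> Prop) : (0 < r)%R ->
  {ae mu, forall x, P x} -> exists2 x, P x & (`|x| < r)%R.
Proof.
move=> r0 [N [mN N0 PN]]; apply: contrapT => H.
have : mu [set x : V | `|x| < r]%R = 0.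
  apply: (subset_measure0 _ mN) => //; first by rewrite open_ball_box//; exact: measurable_box.
  by move=> x xr; apply: PN => Px; apply: H; exists x.
rewrite open_ball_box// => /eqP; rewrite [X in X == _](@lebesgue_row_box _ n) eqe.
rewrite opprK max_r ?addr_ge0 ?(ltW r0)// prodr_const card_ord.
by rewrite expf_eq0 (gt_eqF (addr_gt0 r0 r0)) andbF.
Qed.

(** The essential supremum controls the quotient for almost all pairs. The shear
    [(y, h) |-> (y + h, y)] preserves the measure, and Tonelli turns this into
    a bound for almost all steps [h]. *)
Lemma gagliardo_y_ae (s a : R) u : (0 <= a)%R -> measurable_fun setT u ->
  gagliardo s +oo u <= a%:E ->
  {ae mu, forall h, 'N[mu]_+oo[EFin \o shift_diff h u] <= (a * enorm h `^ s)%:E}.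
Proof.
move=> a0 mu_ /ess_supP ua.
have mn : measurable_fun setT (fun z : V => (enorm z `^ s)^-1)%R.
  under eq_fun do rewrite -powRN.
  apply: (@measurableT_comp _ _ _ _ _ _ (fun t : R => t `^ - s)%R).
    exact: measurable_powR.
  exact: measurable_enorm.
(* the excess of the Hoelder quotient over a *)
pose e (z : V * V) : R :=
  (Num.max 0 (`|u z.1 - u z.2| / enorm (z.1 - z.2) `^ s - a))%R.
have mBz : measurable_fun setT (fun z : V * V => z.1 - z.2)%R.
  exact: measurable_rowB measurable_fst measurable_snd.
have me : measurable_fun setT (fun z => (e z)%:E).
  apply/measurable_EFinP; apply: measurable_maxr => //; apply: measurable_funB => //.
  apply: measurable_funM; last exact: measurableT_comp mn mBz.
  apply: measurableT_comp => //; apply: measurable_funB.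
    exact: measurableT_comp mu_ measurable_fst.
  exact: measurableT_comp mu_ measurable_snd.
have e0 z : 0 <= (e z)%:E by rewrite lee_fin le_max lexx.
pose G (z : V * V) := (e (z.1 + z.2, z.1))%:E%R.
have mG : measurable_fun setT G.
  apply: (measurableT_comp me); apply/measurable_fun_pairP; split.
    exact: measurable_rowD measurable_fst measurable_snd.
  exact: measurable_fst.
have G0 z : 0 <= G z by exact: e0.
have mGG := measurable_fun_fubini_tonelli_G (m1 := mu) G mG G0.
have : \int[mu]_h `| \int[mu]_y G (y, h)| = 0.
  under eq_integral do rewrite gee0_abs ?integral_ge0//.
  rewrite -(fubini_tonelli (m1 := mu) (m2 := mu) G)//.
  transitivity (\int[mu]_y \int[mu]_x (e (x, y))%:E).
    apply: eq_integral => y _.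
    have mey : measurable_fun setT (fun x => (e (x, y))%:E).
      exact: (measurableT_comp me (pair2_measurable y)).
    rewrite -[RHS](ge0_integral_translate y mey (fun x => e0 (x, y))).
    by apply: eq_integral => h _; rewrite /G /= (addrC h).
  transitivity (\int[mu \x mu]_z (e z)%:E).
    exact/esym/(fubini_tonelli2 (m1 := mu) (m2 := mu) (fun z => (e z)%:E) me e0).
  transitivity (\int[mu \x mu]_z cst 0 z); last exact: integral0.
  apply: ge0_ae_eq_integral; [exact: measurableT|exact: me|exact: measurable_cst|
    by move=> z _; exact: e0|by []|].
  apply: filterS ua => z /= h _; congr EFin.
  by rewrite /e max_l// subr_le0 -lee_fin.
move/(ae_eq_integral_abs mu measurableT mGG).
apply: filterS => h /(_ I) Gh.
apply: Lnorm_le_y; first by rewrite lee_fin mulr_ge0 ?powR_ge0.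
have mGh : measurable_fun setT (fun y => G (y, h)).
  exact: (measurableT_comp mG (pair2_measurable h)).
have : \int[mu]_y `|G (y, h)| = 0.
  by under eq_integral do rewrite gee0_abs//; exact: Gh.
move/(ae_eq_integral_abs mu measurableT mGh).
apply: filterS => x /(_ I) /= [ex]; rewrite lee_fin /shift_diff.
have [->|h0] := eqVneq h 0%R.
  by rewrite addr0 subrr normr0 mulr_ge0 ?powR_ge0.
have eh : (0 < enorm h)%R.
  by apply: lt_le_trans (norm_le_enorm h); rewrite normr_gt0.
rewrite -ler_pdivrMr ?powR_gt0// -subr_le0 -ex.
have xh : (x + h - x = h)%R by rewrite addrAC subrr add0r.
by rewrite /e/= xh le_max lexx orbT.
Qed.

Lemma gagliardo_y_ge0 (s : R) u : 0 <= gagliardo s +oo u.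
Proof.
apply: ess_sup_gee.
  have := @product_measure1E _ _ _ _ _ mu mu setT setT measurableT measurableT.
  rewrite setXTT => muT; suff : 0 < mu setT * mu setT by rewrite -muT.
  by apply: mule_gt0; exact: lebesgue_row_gt0.
by apply: nearW => z; rewrite lee_fin divr_ge0// powR_ge0.
Qed.

(** Almost every [z] is such that both [z] and [z - h] are good steps in the
    sense of [gagliardo_y_ae]; take one with [|z| < r] and write
    [h = z - (z - h)]. *)
Lemma Lnorm_shift_diff_y (s r : R) h u : (0 < n)%N ->
  (0 < s < 1)%R -> measurable_fun setT u -> (0 < r)%R -> (`|h| <= r)%R ->
  'N[mu]_+oo[EFin \o shift_diff h u] <= (gainC n * r `^ s)%:E * gagliardo s +oo u.
Proof.
move=> hn /andP[s0 s1] mu_ r0 hr.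
have C0 := gainC_gt0 (R := R) hn.
have CD : (0 < gainC n * r `^ s)%R by rewrite mulr_gt0 ?powR_gt0.
have A0 := gagliardo_y_ge0 s u.
case E : (gagliardo s +oo u) A0 => [a| |]// a0; last by rewrite gt0_muley ?lte_fin// leey.
rewrite lee_fin in a0.
have aE : gagliardo s +oo u <= a%:E by rewrite E.
have wae := gagliardo_y_ae a0 mu_ aE.
have wae2 : {ae mu, forall z,
    'N[mu]_+oo[EFin \o shift_diff z u] <= (a * enorm z `^ s)%:E /\
    'N[mu]_+oo[EFin \o shift_diff (z - h) u] <= (a * enorm (z - h)%R `^ s)%:E}.
  by apply: filterS2 wae (ae_translate (- h)%R wae).
have [z [wz wzh] zr] := ae_exists_small r0 wae2.
have hE : h = (z + - (z - h))%R by rewrite opprB addrC subrK.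
rewrite [X in shift_diff X]hE.
apply: le_trans (Lnorm_shift_diffD _ _ _ _) _; rewrite ?leey//.
rewrite Lnorm_shift_diffN ?leey//; apply: le_trans (leeD wz wzh) _.
rewrite -EFinD lee_fin -mulrDr mulrC ler_wpM2r//.
have bnd (x : V) : (`|x| <= 2 * r)%R -> (enorm x `^ s <= 2 * n%:R * r `^ s)%R.
  move=> xr; have n1 : (1 <= 2 * n%:R :> R)%R.
    by rewrite -[X in (X <= _)%R]mulr1 ler_pM// ler1n.
  apply: (@le_trans _ _ ((2 * n%:R * r) `^ s)%R).
    rewrite ge0_ler_powR ?nnegrE ?enorm_ge0 ?(ltW s0) ?mulr_ge0 ?(ltW r0)//.
    apply: le_trans (enorm_le_norm x) _.
    rewrite [leRHS](_ : _ = n%:R * (2 * r))%R; last by ring.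
    by rewrite ler_wpM2l.
  rewrite powRM ?mulr_ge0 ?(ltW r0)// ler_wpM2r ?powR_ge0//.
  by rewrite ler1_powR// ltW.
apply: (@le_trans _ _ (2 * n%:R * r `^ s + 2 * n%:R * r `^ s)%R).
  rewrite lerD// bnd//; first by rewrite (le_trans (ltW zr))// ler_peMl ?ler1n ?(ltW r0).
  apply: le_trans (ler_normB _ _) _; rewrite mulr_natl mulr2n lerD//; exact: ltW.
rewrite -mulrDl ler_wpM2r ?powR_ge0// /gainC /shellC.
apply: (@le_trans _ _ (4 * (4 * n%:R) ^+ n.+1)%R).
  have -> : (2 * n%:R + 2 * n%:R = 4 * n%:R :> R)%R by ring.
  rewrite ler_wpM2l//; apply: (@le_trans _ _ (4 * n%:R)%R).
    by rewrite ler_peMl// ler1n.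
  apply: ler_eXnr => //; rewrite -[X in (X <= _)%R]mulr1 ler_pM// ler1n//.
rewrite ler_peMl// ?mulr_ge0 ?exprn_ge0 ?mulr_ge0//.
have := expR_ge1Dx (1 : R); lra.
Qed.

End lipschitz_endpoint.

(** * Smooth bump functions *)

Section flat.
Context {R : realType}.
Implicit Types (P : {poly R}) (t y : R).

(** The functions [P(1/t) e^(-1/t)] extended by 0 to [t <= 0]. This family is
    closed under differentiation, which proves smoothness without any explicit
    formula for higher derivatives. *)
Definition flat P t : R := if 0 < t then P.[t^-1] * expR (- t^-1) else 0.

Lemma expRN_monomial_le (k : nat) y : 0 < y -> y ^+ k * expR (- y) <= k`!%:R.
Proof.
move=> y0; rewrite expRN ler_pdivrMr ?expR_gt0//.
case: k => [|k].
  by rewrite expr0 fact0 mul1r; apply: le_trans _ (expR_ge1Dx _); rewrite lerDl ltW.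
have h := expR_ge1Dxn k (ltW y0).
rewrite mulrC -ler_pdivrMr ?ltr0n ?fact_gt0//; apply: le_trans _ h.
by rewrite lerDr.
Qed.

Lemma flat_bounded P : exists M, forall t, `|flat P t| <= M.
Proof.
exists (\sum_(i < size P) `|P`_i| * (i`!)%:R) => t; rewrite /flat.
case: ifPn => t0; last by rewrite normr0 sumr_ge0// => i _; rewrite mulr_ge0.
have y0 : 0 < t^-1 by rewrite invr_gt0.
rewrite normrM (gtr0_norm (expR_gt0 _)) horner_coef.
apply: (@le_trans _ _ ((\sum_(i < size P) `|P`_i * t^-1 ^+ i|) * expR (- t^-1))).
  by rewrite ler_wpM2r ?expR_ge0// ler_norm_sum.
rewrite mulr_suml; apply: ler_sum => i _.
rewrite normrM -mulrA ler_wpM2l// ger0_norm ?exprn_ge0 ?(ltW y0)//.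
exact: expRN_monomial_le.
Qed.

(** Gives the derivative 0 at the origin, the only point where the definition
    by cases matters. *)
Lemma flat_quadratic P : exists M, forall t, `|flat P t| <= M * t ^+ 2.
Proof.
have [M PM] := flat_bounded ('X^2 * P); exists M => t.
have [t0|t0] := ltP 0 t; last first.
  rewrite /flat ltNge t0/= normr0 mulr_ge0 ?sqr_ge0//.
  exact: le_trans (PM 0).
have -> : flat P t = flat ('X^2 * P) t * t ^+ 2.
  have tn0 : t != 0 by rewrite gt_eqF.
  by rewrite /flat t0 hornerM hornerXn; field.
by rewrite normrM (@ger0_norm _ (t ^+ 2)) ?sqr_ge0// ler_wpM2r ?sqr_ge0.
Qed.

Definition flat_deriv P : {poly R} := 'X^2 * (P - P^`()).

Lemma is_derive_flat P t : is_derive t 1 (flat P) (flat (flat_deriv P) t).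
Proof.
have [t0|t0|<-] := ltgtP 0 t.
- pose g := fun x : R => P.[x] * expR (- x).
  have nE : \near t, (g \o @GRing.inv R) t = flat P t.
    by near=> x; rewrite /flat ifT//; near: x; exact: lt_nbhsr.
  apply: (near_eq_is_derive nE).
  have tn0 : t != 0 by rewrite gt_eqF.
  have dV : is_derive t 1 (@GRing.inv R) (- t ^- 2).
    apply: (is_derive_eq (is_deriveV tn0 _)).
    by rewrite scaler1.
  have dg : is_derive t^-1 1 g (P^`().[t^-1] * expR (- t^-1) - P.[t^-1] * expR (- t^-1)).
    have dN : is_derive t^-1 1 (expR \o -%R) (expR (- t^-1) * -1).
      exact: is_derive1_comp.
    apply: (is_derive_eq (is_deriveM _ dN)).
    rewrite /= mulrN1 ![_ *: _]mulrC. ring.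
  apply: (is_derive_eq (is_derive1_comp dg dV)).
  rewrite /flat t0 /flat_deriv hornerM hornerXn hornerD hornerN exprVn; ring.
- have nE : \near t, cst 0 t = flat P t.
    near=> x; rewrite /flat ifF//; apply/negbTE; rewrite -leNgt ltW//.
    by near: x; exact: lt_nbhsl.
  rewrite {2}/flat ltNge (ltW t0)/=.
  exact: (near_eq_is_derive nE).
have [M PM] := flat_quadratic P.
have M0 : 0 <= M by have := PM 1; rewrite expr1n mulr1; exact: le_trans.
have f0 Q : flat Q 0 = 0 by rewrite /flat ltxx.
have cv : (h^-1 *: (flat P (h *: 1 + 0) - flat P 0) : R) @[h --> 0^'] --> (0 : R).
  apply/cvgr0Pnorm_le => e e0; near=> h.
  have h0 : h != 0 by near: h; exact: nbhs_dnbhs_neq.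
  rewrite f0 subr0 addr0 scaler1 normrZ normfV.
  rewrite ler_pdivrMl ?normr_gt0//; apply: le_trans (PM h) _.
  rewrite -real_normK ?num_real// expr2 mulrA [leRHS]mulrC ler_wpM2r//.
  apply: (@le_trans _ _ ((M + 1) * `|h|)); first by rewrite ler_wpM2r// lerDl.
  rewrite mulrC -ler_pdivlMr ?ltr_wpDl//.
  by near: h; apply: dnbhs0_le; rewrite divr_gt0// ltr_wpDl.
rewrite f0; apply: DeriveDef; first by apply/cvg_ex; exists 0.
by rewrite /derive; apply/cvg_lim.
Unshelve. all: by end_near.
Qed.

Lemma continuous_flat P : continuous (flat P).
Proof.
move=> t; apply: differentiable_continuous; apply/derivable1_diffP.
by have [] := is_derive_flat P t.
Qed.

End flat.

Section smooth_functions.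
Context {R : realType} (n : nat).
Local Notation V := 'rV[R]_n.
Implicit Types (f g : V -> R) (k : nat).

(** Reduces a directional derivative to a derivative in one real variable. *)
Lemma is_derive_line f (G : R -> R) (x v : V) (t dg : R) :
  (forall h, f (h *: v + x) = G (h + t)) -> is_derive t 1 G dg ->
  is_derive x v f dg.
Proof.
move=> fG [Gt Gdg].
have E : (fun h : R => h^-1 *: ((f \o shift x) (h *: v) - f x)) =
         (fun h => h^-1 *: ((G \o shift t) (h *: 1) - G t)).
  apply/funext => h /=; rewrite fG scaler1.
  by have := fG 0; rewrite scale0r !add0r => ->.
by apply: DeriveDef; rewrite /derivable /derive E.
Qed.

Lemma is_CkW k f : is_Ck k.+1 f -> is_Ck k f.
Proof.
elim: k f => [|k IH] f; first by case.
move=> [cf df]; split=> // i; split; first by have [] := df i.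
by apply: IH; have [] := df i.
Qed.

Lemma is_CkD k f g : is_Ck k f -> is_Ck k g -> is_Ck k (fun x => f x + g x).
Proof.
elim: k f g => [|k IH] f g.
  by move=> /= cf cg x; exact: (cvgD (cf x) (cg x)).
move=> [cf df] [cg dg]; split=> [x|i].
  by exact: (cvgD (cf x) (cg x)).
have [dfi cfi] := df i; have [dgi cgi] := dg i.
split=> [x|]; first exact: derivableD.
rewrite (_ : partial i _ = fun x => partial i f x + partial i g x); first exact: IH.
by apply/funext => x; rewrite /partial deriveD.
Qed.

Lemma is_CkM k f g : is_Ck k f -> is_Ck k g -> is_Ck k (fun x => f x * g x).
Proof.
elim: k f g => [|k IH] f g.
  by move=> /= cf cg x; exact: (cvgM (cf x) (cg x)).
move=> Cf Cg; have [cf df] := Cf; have [cg dg] := Cg.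
split=> [x|i]; first by exact: (cvgM (cf x) (cg x)).
have [dfi cfi] := df i; have [dgi cgi] := dg i.
split=> [x|]; first exact: derivableM.
rewrite (_ : partial i _ = fun x => f x * partial i g x + g x * partial i f x).
  by apply: is_CkD; apply: IH => //; exact: is_CkW.
by apply/funext => x; rewrite /partial deriveM.
Qed.

Lemma is_Ck_cst k (c : R) : is_Ck k (fun _ : V => c).
Proof.
elim: k c => [|k IH] c; first exact: cst_continuous.
split=> [|i]; first exact: cst_continuous.
split=> [x|]; first exact: derivable_cst.
rewrite (_ : partial i _ = fun=> 0) //.
by apply/funext => x; rewrite /partial derive_cst.
Qed.

Lemma is_Ck_prod k (I : Type) (s : seq I) (F : I -> V -> R) :
  (forall i, is_Ck k (F i)) -> is_Ck k (fun x => \prod_(i <- s) F i x).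
Proof.
move=> CF; elim: s => [|i s IH].
  rewrite (_ : (fun x => _) = fun=> 1); first exact: is_Ck_cst.
  by apply/funext => x; rewrite big_nil.
rewrite (_ : (fun x => _) = fun x => F i x * \prod_(i <- s) F i x).
  exact: is_CkM.
by apply/funext => x; rewrite big_cons.
Qed.

Lemma is_Ck_flat k (P : {poly R}) i (c d : R) :
  is_Ck k (fun x : V => flat P (c * x ord0 i + d)).
Proof.
have cont Q : continuous (fun x : V => flat Q (c * x ord0 i + d)).
  move=> x; apply: (continuous_comp (f := fun x : V => c * x ord0 i + d));
    last exact: continuous_flat.
  have H := @coord_continuous R 1 n ord0 i x.
  exact: (cvgD (cvgM (cvg_cst c) H) (cvg_cst d)).
have der Q j (x : V) : is_derive x (delta_mx ord0 j)
    (fun x : V => flat Q (c * x ord0 i + d))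
    ((c * (i == j)%:R) * flat (flat_deriv Q) (c * x ord0 i + d)).
  pose L (t : R) := c * (t * (i == j)%:R + x ord0 i) + d.
  have dL : is_derive (0 : R) 1 L (c * (i == j)%:R).
    rewrite /L (_ : (fun t => _) = (fun t => (c * (i == j)%:R) * t + (c * x ord0 i + d))).
      by apply: is_derive_eq; rewrite addr0 /=; exact: mulr1.
    by apply/funext => t; ring.
  have h := is_derive1_comp (is_derive_flat Q (L 0)) dL.
  apply: (@is_derive_line _ (flat Q \o L) _ _ 0).
    by move=> t; rewrite /= /L !mxE eqxx addr0 andTb eq_sym.
  by apply: (is_derive_eq h); rewrite /L mul0r add0r mulrC.
elim: k P => [|k IH] P; first exact: cont.
split=> [|j]; first exact: cont.
split=> [x|]; first by have [] := der P j x.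
rewrite (_ : partial j _ = fun x => (c * (i == j)%:R) * flat (flat_deriv P) (c * x ord0 i + d)).
  by apply: is_CkM; [exact: is_Ck_cst|exact: IH].
by apply/funext => x; rewrite /partial; have [_ ->] := der P j x.
Qed.

End smooth_functions.

Section bumps.
Context {R : realType} (n : nat).
Local Notation V := 'rV[R]_n.
Implicit Types (a b : 'I_n -> R) (N : R).

Definition bump1 N (a b t : R) : R := flat 1 (N * (t - a)) * flat 1 (N * (b - t)).

(** For [N > 0] it is smooth, positive exactly on the box, and increases to
    the indicator of the box as [N] tends to infinity. *)
Definition bumpf N a b (x : V) : R := \prod_(i < n) bump1 N (a i) (b i) (x ord0 i).

Lemma flat1_01 (t : R) : 0 <= flat 1 t <= 1.
Proof.
rewrite /flat; case: ifP => [t0|_]; last by rewrite lexx ler01.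
by rewrite hornerC mul1r expR_ge0/= -expR0 ler_expR oppr_le0 invr_ge0 ltW.
Qed.

Lemma bump1_01 N (a b t : R) : 0 <= bump1 N a b t <= 1.
Proof.
have /andP[? ?] := flat1_01 (N * (t - a)); have /andP[? ?] := flat1_01 (N * (b - t)).
by rewrite mulr_ge0// mulr_ile1.
Qed.

Lemma bump_01 N a b x : 0 <= bumpf N a b x <= 1.
Proof.
rewrite /bumpf; elim/big_ind: _ => [|y z /andP[y0 y1] /andP[z0 z1]|i _].
- by rewrite ler01 lexx.
- by rewrite mulr_ge0// mulr_ile1.
- exact: bump1_01.
Qed.

Lemma bump1_out N (a b t : R) : 0 < N -> ~~ (a < t < b) -> bump1 N a b t = 0.
Proof.
move=> N0; rewrite negb_and -!leNgt => /orP[ta|bt]; rewrite /bump1 /flat.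
  by rewrite ltNge mulr_ge0_le0 ?subr_le0 ?(ltW N0)//= mul0r.
by rewrite [X in _ * (if X then _ else _)]ltNge mulr_ge0_le0 ?subr_le0 ?(ltW N0)//= mulr0.
Qed.

Lemma bump_out N a b x : 0 < N -> ~ box a b x -> bumpf N a b x = 0.
Proof.
move=> N0 /existsNP[i /negP xi]; rewrite /bumpf (bigD1 i)//=.
by rewrite bump1_out ?mul0r.
Qed.

Lemma is_Ck_bump k N a b : is_Ck k (bumpf N a b).
Proof.
apply: is_Ck_prod => i; apply: is_CkM.
  have := is_Ck_flat k 1 i N (- (N * a i)); congr is_Ck; apply/funext => x.
  by rewrite mulrBr.
have := is_Ck_flat k 1 i (- N) (N * b i); congr is_Ck; apply/funext => x.
by rewrite mulrBr mulNr addrC.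
Qed.

Definition cbox a b : set V := [set x | forall i, `[a i, b i]%classic (x ord0 i)].

Lemma compact_cbox a b : compact (cbox a b).
Proof.
apply: (@rV_compact _ n (fun i => `[a i, b i]%classic)) => i.
exact: segment_compact.
Qed.

Lemma test_function_bump N a b : 0 < N -> test_function (bumpf N a b).
Proof.
move=> N0; split=> [k|]; first exact: is_Ck_bump.
have cb : compact (cbox a b) by exact: compact_cbox.
have clb : closed (cbox a b).
  by apply: compact_closed => //; exact: norm_hausdorff.
apply: (subclosed_compact _ cb); first exact: closed_closure.
rewrite ((closure_id _).1 clb); apply: closureS => x /= /eqP bx i.
have xab : box a b x by apply: contrapT => /(bump_out N0).
by have /andP[? ?] := xab i; rewrite /= in_itv/= !ltW.
Qed.

Lemma bump_shift N a b (h x : V) :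
  bumpf N a b (x - h) = bumpf N (fun i => a i + h ord0 i) (fun i => b i + h ord0 i) x.
Proof.
apply: eq_bigr => i _; rewrite !mxE /bump1; congr (flat _ (_ * _) * flat _ (_ * _)); ring.
Qed.

Lemma partial_bump_shift N a b (h x : V) i :
  partial i (bumpf N a b) (x - h) =
  partial i (bumpf N (fun i => a i + h ord0 i) (fun i => b i + h ord0 i)) x.
Proof.
rewrite /partial /derive; congr (lim _); apply: (congr1 (fun g : R -> R => g @ 0^')).
apply/funext => t.
by rewrite /= -!bump_shift !addrA.
Qed.

Lemma bump_cvg a b (x : V) : box a b x ->
  bumpf m.+1%:R a b x @[m --> \oo] --> (1 : R).
Proof.
move=> xab.
have flat_cvg t : 0 < t -> flat 1 (m.+1%:R * t) @[m --> \oo] --> (1 : R).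
  move=> t0.
  have -> : (fun m => flat 1 (m.+1%:R * t)) = (fun m : nat => expR (- (m.+1%:R^-1 * t^-1))).
    apply/funext => m; rewrite /flat mulr_gt0 ?ltr0n// hornerC mul1r.
    by rewrite invfM.
  have H : (fun m : nat => - (m.+1%:R^-1 * t^-1)) @ \oo --> (0 : R).
    rewrite -oppr0 -(mul0r t^-1); apply: cvgN; apply: cvgMl; exact: cvg_harmonic.
  rewrite -[X in _ --> X]expR0; exact: (cvg_comp _ _ H (@continuous_expR R 0)).
have E1 : (1 : R) = \prod_(i < n) (1 * 1) by rewrite big1// => i _; rewrite mulr1.
rewrite [X in _ --> X]E1.
rewrite /bumpf /bump1; elim: (index_enum _) {E1} => [|i s IH].
  by rewrite big_nil; under eq_fun do rewrite big_nil; exact: cvg_cst.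
rewrite big_cons; under eq_fun do rewrite big_cons.
have /andP[ax xb] := xab i; rewrite -subr_gt0 in ax; rewrite -subr_gt0 in xb.
exact: (cvgM (cvgM (flat_cvg _ ax) (flat_cvg _ xb)) IH).
Qed.

Definition dbump1 N (a b t : R) : R :=
  N * flat (flat_deriv 1) (N * (t - a)) * flat 1 (N * (b - t)) -
  N * flat 1 (N * (t - a)) * flat (flat_deriv 1) (N * (b - t)).

Lemma is_derive_bump1 N (a b t : R) : is_derive t 1 (bump1 N a b) (dbump1 N a b t).
Proof.
have dlin c d : is_derive t 1 (fun t : R => c * t + d) c.
  by apply: is_derive_eq; rewrite addr0 /=; exact: mulr1.
have d1 : is_derive t 1 (fun t : R => N * (t - a)) N.
  rewrite (_ : (fun t => _) = (fun t => N * t + - (N * a)))//.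
  by apply/funext => u; ring.
have d2 : is_derive t 1 (fun t : R => N * (b - t)) (- N).
  rewrite (_ : (fun t => _) = (fun t => - N * t + N * b))//.
  by apply/funext => u; ring.
apply: (is_derive_eq (is_deriveM (is_derive1_comp (is_derive_flat 1 _) d1)
   (is_derive1_comp (is_derive_flat 1 _) d2))).
by rewrite /dbump1 /= /GRing.scale/=; ring.
Qed.

Lemma partial_bumpE N a b i (x : V) : partial i (bumpf N a b) x =
  dbump1 N (a i) (b i) (x ord0 i) *
  \prod_(j < n | j != i) bump1 N (a j) (b j) (x ord0 j).
Proof.
set c := \prod_(j < n | _) _.
suff [_ h] : is_derive x (delta_mx ord0 i) (bumpf N a b)
  (dbump1 N (a i) (b i) (x ord0 i) * c) by exact: h.
apply: (@is_derive_line _ _ _ (fun t => bump1 N (a i) (b i) t * c) _ _ (x ord0 i)).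
  move=> h; rewrite /bumpf (bigD1 i)//= !mxE !eqxx mulr1; congr (_ * _).
  by apply: eq_bigr => j ji; rewrite !mxE (negbTE ji) andbF mulr0 add0r.
have dc : is_derive (x ord0 i) 1 (fun _ : R => c) 0 by exact: is_derive_cst.
apply: (is_derive_eq (is_deriveM (is_derive_bump1 _ _ _ _) dc)).
by rewrite scaler0 add0r /GRing.scale/= mulrC.
Qed.

End bumps.

(** * The fundamental lemma of the calculus of variations *)

Section density.
Context d (T : measurableType d) (R : realType) (m : {measure set T -> \bar R}).
Variables (f : T -> \bar R) (mf : measurable_fun setT f) (f0 : forall x, (0 <= f x)%E).
Local Open Scope ereal_scope.

(** The measure [f m]; it lets the uniqueness of measures on boxes compare the
    positive and negative parts of a function in [fundamental_lemma]. *)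
Definition density (A : set T) : \bar R := \int[m]_(x in A) f x.

Let density0 : density set0 = 0.
Proof. by rewrite /density integral_set0. Qed.

Let density_ge0 A : 0 <= density A.
Proof. by apply: integral_ge0 => x _; exact: f0. Qed.

Let density_sigma_additive : semi_sigma_additive density.
Proof.
move=> A mA tA mUA; rewrite /density ge0_integral_bigcup//.
- by apply: is_cvg_ereal_nneg_natsum_cond => k _ _; exact: density_ge0.
- exact: measurable_funTS.
Qed.

HB.instance Definition _ := isMeasure.Build _ _ _ density
  density0 density_ge0 density_sigma_additive.

Definition density_measure : {measure set T -> \bar R} := density.

End density.

Section fundamental_lemma.
Context {R : realType} (n : nat).
Local Notation V := 'rV[R]_n.
Local Notation mu := (@lebesgue_row R n).
Implicit Types (f : V -> R) (a b : 'I_n -> R).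
Local Open Scope ereal_scope.

(** Local integrability, tested on the cubes only. *)
Definition box_integrable f : Prop := measurable_fun setT f /\
  forall k, mu.-integrable (cube n k) (EFin \o f).

(** A single cube contains all translates of a box by steps of length at most
    [t]. *)
Lemma box_sub_cube a b (t : R) :
  exists k, forall x h : V, (`|h| <= t)%R -> box a b (x - h)%R -> cube n k x.
Proof.
pose C := (\sum_i (`|a i| + `|b i|) + `|t|)%R.
exists (Num.bound C) => x h ht xab i /=.
have := xab i; rewrite !mxE => /andP[ax xb].
have hi := le_trans (coord_le_norm h i) (le_trans ht (ler_norm _)).
have iC : (`|a i| + `|b i| <= \sum_i (`|a i| + `|b i|))%R.
  by rewrite (bigD1 i)//= lerDl sumr_ge0// => j _; rewrite addr_ge0.
rewrite -ltr_norml; apply: le_lt_trans (archi_boundP _); last first.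
  by rewrite addr_ge0// sumr_ge0// => j _; rewrite addr_ge0.
rewrite /C; have := ler_norm (- a i)%R; have := ler_norm (b i); rewrite normrN.
move: hi; rewrite ler_norml => /andP[h1 h2] h3 h4.
have := normr_ge0 (a i); have := normr_ge0 (b i) => h5 h6.
by rewrite ler_norml; apply/andP; split; lra.
Qed.

Lemma measurable_bump N a b : measurable_fun setT (@bumpf R n N a b).
Proof.
apply: measurable_prod => i _.
have mflat : measurable_fun setT (@flat R 1).
  apply: continuous_measurable_fun => t; exact: continuous_flat.
have mi : measurable_fun setT (fun x : V => x ord0 i) := measurable_coord i.
apply: measurable_funM; apply: (measurableT_comp mflat).
  by apply: measurable_funM => //; exact: measurable_funB.
by apply: measurable_funM => //; exact: measurable_funB.
Qed.

Lemma box_integrable_mul f (beta : V -> R) (M : R) (k : nat) :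
  box_integrable f -> measurable_fun setT beta ->
  (forall x, `|beta x| <= M)%R -> (forall x, beta x != 0 -> cube n k x)%R ->
  mu.-integrable setT (fun x => (f x * beta x)%:E).
Proof.
move=> [mf fk] mb bM b0.
have mck : measurable (@cube R n k) by exact: measurable_box.
have ik := (integrable_mkcond (EFin \o f) mck).1 (fk k).
apply: (@le_integrable _ _ _ _ setT _ _ (fun x => M%:E * ((EFin \o f) \_ (cube n k)) x)) => //.
- by apply/measurable_EFinP; exact: measurable_funM.
- move=> x _; rewrite patchE; case: ifPn => [|/negP xk].
    rewrite inE => xk; rewrite -EFinM !abse_EFin lee_fin !normrM mulrC ler_wpM2r//.
    exact: le_trans (bM x) (ler_norm _).
  have [->|/b0 xk'] := eqVneq (beta x) 0%R; first by rewrite mulr0 abse0.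
  by exfalso; apply: xk; rewrite inE.
- exact: integrableZl.
Qed.

Lemma box_integrable_bump f N a b : (0 < N)%R -> box_integrable f ->
  mu.-integrable setT (fun x => (f x * bumpf N a b x)%:E).
Proof.
move=> N0 bf; have [k kab] := box_sub_cube a b 0.
apply: (box_integrable_mul (k := k) (M := 1) bf); first exact: measurable_bump.
  by move=> x; have /andP[? ?] := bump_01 N a b x; rewrite ger0_norm.
move=> x h; apply: (kab x 0%R); rewrite ?normr0// subr0.
by apply: contrapT => /(bump_out N0) /eqP; exact/negP.
Qed.

Lemma box_integrable_translate f (h : V) :
  box_integrable f -> box_integrable (fun x => f (x + h)%R).
Proof.
move=> bf; have [mf _] := bf; split=> [|k].
  exact: measurableT_comp mf (measurable_translate h).
have mck : measurable (@cube R n k) by exact: measurable_box.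
have [K hK] := box_sub_cube (fun=> - k%:R)%R (fun=> k%:R)%R `|h|.
have I : mu.-integrable setT (fun x : V => (f x * \1_(cube n k) (x - h)%R)%:E).
  apply: (box_integrable_mul (M := 1) (k := K) bf).
  - have mI : measurable_fun setT (\1_(cube n k) : V -> R) by exact: measurable_indic.
    exact: (measurableT_comp mI (measurable_translate (- h)%R)).
  - by move=> x; rewrite ger0_norm// indicE; case: (_ \in _).
  - move=> x; rewrite indicE; case: (boolP (_ \in _)) => [|_]; last by rewrite eqxx.
    by rewrite inE => xk _; exact: hK xk.
have := integrable_translate h I; move/(integrableS measurableT mck (@subsetT _ _)).
apply: eq_integrable => // x; rewrite inE => xk.
by rewrite addrK indicE mem_set// mulr1.
Qed.

(** Dominated convergence: the bumps converge to 1 on the box. *)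
Lemma integral_box_eq0 f a b : box_integrable f ->
  (forall N, (0 < N)%R -> \int[mu]_x (f x * bumpf N a b x)%:E = 0) ->
  \int[mu]_(x in box a b) (f x)%:E = 0.
Proof.
move=> If fb; have [mf fk] := If.
have mab : measurable (box a b) by exact: measurable_box.
have [k kab] := box_sub_cube a b 0.
have abk : box a b `<=` cube n k.
  by move=> x xab; apply: (kab x 0%R); rewrite ?normr0// subr0.
have mck : measurable (@cube R n k) by exact: measurable_box.
have ib : mu.-integrable (box a b) (EFin \o f) by exact: integrableS (fk k).
have bump_in m x : (`|bumpf m.+1%:R a b x| <= 1)%R.
  by have /andP[h0 h1] := bump_01 m.+1%:R a b x; rewrite ger0_norm.
have cvI : (fun m : nat => \int[mu]_(x in box a b) (f x * bumpf m.+1%:R a b x)%:E) @ \oo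
    --> \int[mu]_(x in box a b) (f x)%:E.
  apply: (@dominated_cvg _ _ _ mu _ mab _ _ (fun x => `|(f x)%:E|)) => //.
  - move=> m; apply/measurable_EFinP; apply: measurable_funTS.
    by apply: measurable_funM => //; exact: measurable_bump.
  - move=> x xab; apply: cvg_EFin; first exact: nearW.
    rewrite -[X in _ --> X]mulr1; apply: cvgMr; exact: bump_cvg.
  - exact: integrable_abse.
  - move=> m x xab; rewrite lee_fin normrM -[leRHS]mulr1.
    by rewrite ler_wpM2l.
have E m : \int[mu]_(x in box a b) (f x * bumpf m.+1%:R a b x)%:E = 0.
  rewrite -(fb m.+1%:R)// integral_mkcond; apply: eq_integral => x _.
  rewrite patchE; case: ifPn => // /negP xab.
  by rewrite bump_out ?mulr0// => h; apply: xab; rewrite inE.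
by rewrite -(cvg_lim _ cvI)//; under eq_fun do rewrite E; rewrite lim_cst.
Qed.

(** The measures with densities [f^+] and [f^-] agree on boxes, hence on the
    sets where [f > 0] and where [f < 0]; on each of these one of them
    vanishes. *)
Lemma fundamental_lemma f : box_integrable f ->
  (forall N a b, (0 < N)%R -> \int[mu]_x (f x * bumpf N a b x)%:E = 0) ->
  {ae mu, forall x, f x = 0%R}.
Proof.
move=> If fb; have [mf fk] := If.
have mE : measurable_fun setT (EFin \o f) by exact/measurable_EFinP.
have mp := measurable_funepos mE; have mn := measurable_funeneg mE.
pose mp_ := density_measure mu mp (funepos_ge0 (EFin \o f)).
pose mn_ := density_measure mu mn (funeneg_ge0 (EFin \o f)).
have fin_ a b : \int[mu]_(x in box a b) (EFin \o f)^\+ x \is a fin_num /\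
    \int[mu]_(x in box a b) (EFin \o f)^\- x \is a fin_num.
  have [k kab] := box_sub_cube a b 0.
  have ib : mu.-integrable (box a b) (EFin \o f).
    apply: integrableS (fk k) => //; [exact: measurable_box|exact: measurable_box|].
    by move=> x xab; apply: (kab x 0%R); rewrite ?normr0// subr0.
  have mab : measurable (box a b) by exact: measurable_box.
  by split; [exact: integrable_pos_fin_num|exact: integrable_neg_fin_num].
have mpn a b : mp_ (box a b) = mn_ (box a b).
  have := integral_box_eq0 If (fun N => fb N a b); rewrite integralE.
  have [fp fn] := fin_ a b.
  by move=> /eqP; rewrite sube_eq ?add0e ?fin_num_adde_defr// => /eqP.
have eqpn A : measurable A -> mp_ A = mn_ A.
  apply: measure_row_unique => // k.
  have [+ _] := fin_ (fun=> - k%:R)%R (fun=> k%:R)%R.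
  by rewrite ge0_fin_numE// integral_ge0.
have null (g : V -> \bar R) (A : set V) : measurable_fun setT g ->
    (forall x, 0 <= g x) -> A = [set x | 0 < g x] ->
    \int[mu]_(x in A) g x = 0 -> {ae mu, forall x, g x = 0}.
  move=> mg g0 AE Ag.
  have mA : measurable A.
    by rewrite AE -[X in measurable X]setTI; exact: emeasurable_fun_o_infty.
  have : \int[mu]_x `|g x| = 0.
    rewrite -[RHS]Ag [RHS]integral_mkcond; apply: eq_integral => x _.
    rewrite patchE gee0_abs//; case: ifPn => // /negP xA; apply/eqP.
    rewrite eq_le g0 andbT leNgt; apply/negP => gx; apply: xA.
    by rewrite inE AE.
  move/(ae_eq_integral_abs mu measurableT mg).
  by apply: filterS => x /(_ I).
have mpos : measurable [set x | 0 < (EFin \o f)^\+ x].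
  by rewrite -[X in measurable X]setTI; exact: emeasurable_fun_o_infty.
have mneg : measurable [set x | 0 < (EFin \o f)^\- x].
  by rewrite -[X in measurable X]setTI; exact: emeasurable_fun_o_infty.
have p0 : {ae mu, forall x, (EFin \o f)^\+ x = 0}.
  apply: null erefl _ => //.
  have := eqpn _ mpos; rewrite /mp_ /mn_ /density_measure/= /density => ->.
  apply: integral0_eq => x /=; rewrite funeposE funenegE /= lt_max ltxx orbF lte_fin => fx.
  by rewrite max_r// lee_fin oppr_le0 ltW.
have n0 : {ae mu, forall x, (EFin \o f)^\- x = 0}.
  apply: null erefl _ => //.
  have := eqpn _ mneg; rewrite /mp_ /mn_ /density_measure/= /density => <-.
  apply: integral0_eq => x /=; rewrite funeposE funenegE /= lt_max ltxx orbF lte_fin oppr_gt0 => fx.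
  by rewrite max_r// lee_fin ltW.
apply: filterS2 p0 n0 => x; rewrite funeposE funenegE /= => h1 h2.
have : (f x)%:E <= 0 by rewrite -h1 le_max lexx.
rewrite lee_fin => fle0.
have : - (f x)%:E <= 0 by rewrite -h2 le_max lexx.
rewrite -EFinN lee_fin => fge0.
by apply/eqP; rewrite eq_le fle0 -oppr_le0.
Qed.

End fundamental_lemma.

(** * Weak partial derivatives tested on bumps *)

Section measurable_parametric_integral.
Context d1 d2 (T1 : measurableType d1) (T2 : measurableType d2) (R : realType).
Variable m2 : {sigma_finite_measure set T2 -> \bar R}.
Local Open Scope ereal_scope.

(** Tonelli's theorem gives the measurability for the positive and the negative
    part separately, whether or not the sections are integrable. *)
Lemma measurable_fun_integral2 (f : T1 * T2 -> \bar R) :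
  measurable_fun setT f -> measurable_fun setT (fun x => \int[m2]_y f (x, y)).
Proof.
move=> mf.
have mp := measurable_fun_fubini_tonelli_F (m2 := m2) _ (measurable_funepos mf) (funepos_ge0 f).
have mn := measurable_fun_fubini_tonelli_F (m2 := m2) _ (measurable_funeneg mf) (funeneg_ge0 f).
rewrite (_ : (fun x => _) = (fun x => fubini_F m2 f^\+ x - fubini_F m2 f^\- x)).
  exact: emeasurable_funB.
apply/funext => x; rewrite integralE; congr (_ - _).
  by apply: eq_integral => y _; rewrite !funeposE.
by apply: eq_integral => y _; rewrite !funenegE.
Qed.

End measurable_parametric_integral.

Section weak_partial_bumps.
Context {R : realType} (n : nat).
Local Notation V := 'rV[R]_n.
Local Notation mu := (@lebesgue_row R n).
Implicit Types (u v f : V -> R) (a b : 'I_n -> R) (i : 'I_n) (N : R).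
Local Open Scope ereal_scope.

(** Bumps separate locally integrable functions, so they test a weak derivative
    faithfully; and translating a bump gives a bump, which makes this property
    visibly stable under translation of [u] and [v].
    The sign stands inside the integral, where it is absorbed in the test
    function. *)
Definition weak_partial_on_bumps i u v : Prop :=
  [/\ box_integrable u, box_integrable v & forall N a b, (0 < N)%R ->
    \int[mu]_x (u x * - partial i (bumpf N a b) x)%:E =
    \int[mu]_x (v x * bumpf N a b x)%:E].

Lemma partial_bump_out i N a b x : (0 < N)%R -> ~ box a b x ->
  partial i (bumpf N a b) x = 0%R.
Proof.
move=> N0 /existsNP[j /negP xj]; rewrite partial_bumpE.
have [ji|ji] := eqVneq j i; last first.
  by rewrite (bigD1 j)//= bump1_out ?mul0r ?mulr0.
have F (P : {poly R}) (c : R) : (c <= 0)%R -> flat P c = 0%R by move=> c0; rewrite /flat ltNge c0.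
rewrite ji in xj; rewrite /dbump1; move: xj; rewrite negb_and -!leNgt => /orP[xa|bx].
  have h : (N * (x ord0 i - a i) <= 0)%R by rewrite mulr_ge0_le0 ?subr_le0 ?(ltW N0).
  by rewrite !(F _ _ h) !(mulr0, mul0r) subrr mul0r.
have h : (N * (b i - x ord0 i) <= 0)%R by rewrite mulr_ge0_le0 ?subr_le0 ?(ltW N0).
by rewrite !(F _ _ h) !mulr0 subrr mul0r.
Qed.

Lemma partial_bump_bounded i N a b : (0 < N)%R ->
  exists M, forall x, (`|partial i (bumpf N a b) x| <= M)%R.
Proof.
move=> N0; have [M FM] := flat_bounded (flat_deriv (1 : {poly R})).
exists (N * M + N * M)%R => x; rewrite partial_bumpE normrM.
have F1 c : (`|flat (1 : {poly R}) c| <= 1)%R.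
  by have /andP[? ?] := flat1_01 c; rewrite ger0_norm.
have M0 : (0 <= M)%R by exact: le_trans (FM 0%R).
rewrite -[leRHS]mulr1 ler_pM//.
  rewrite /dbump1; apply: le_trans (ler_normB _ _) _.
  rewrite !normrM (gtr0_norm N0) lerD//.
    by rewrite -[leRHS]mulr1 ler_pM ?mulr_ge0 ?(ltW N0)// ler_wpM2l ?(ltW N0).
  rewrite -mulrA ler_wpM2l ?(ltW N0)// mulrC -[leRHS]mulr1 ler_pM//.
have /andP[p0 p1] : (0 <= \prod_(j < n | j != i) bump1 N (a j) (b j) (x ord0 j) <= 1)%R.
  elim/big_ind: _ => [|y z /andP[y0 y1] /andP[z0 z1]|j _].
  - by rewrite ler01 lexx.
  - by rewrite mulr_ge0// mulr_ile1.
  - exact: bump1_01.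
by rewrite ger0_norm.
Qed.

Lemma measurable_partial_bump i N a b :
  measurable_fun setT (partial i (@bumpf R n N a b)).
Proof.
have mflat P : measurable_fun setT (@flat R P).
  apply: continuous_measurable_fun => t; exact: continuous_flat.
have mi j : measurable_fun setT (fun x : V => x ord0 j) := measurable_coord j.
have ml P j : measurable_fun setT (fun x : V => flat P (N * (x ord0 j - a j))%R).
  apply: (measurableT_comp (mflat P)).
  by apply: measurable_funM => //; exact: measurable_funB.
have mr P j : measurable_fun setT (fun x : V => flat P (N * (b j - x ord0 j))%R).
  apply: (measurableT_comp (mflat P)).
  by apply: measurable_funM => //; exact: measurable_funB.
rewrite (_ : partial i _ = fun x : V => (dbump1 N (a i) (b i) (x ord0 i) *
  \prod_(j < n | j != i) bump1 N (a j) (b j) (x ord0 j))%R); last first.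
  by apply/funext => x; rewrite partial_bumpE.
apply: measurable_funM.
  by apply: measurable_funB; apply: measurable_funM => //; exact: measurable_funM.
under eq_fun do rewrite -big_filter.
by apply: measurable_prod => j _; exact: measurable_funM.
Qed.

Lemma box_integrable_partial i f N a b : (0 < N)%R -> box_integrable f ->
  mu.-integrable setT (fun x => (f x * partial i (bumpf N a b) x)%:E).
Proof.
move=> N0 bf; have [k kab] := box_sub_cube a b 0.
have [M PM] := partial_bump_bounded i a b N0.
apply: (box_integrable_mul (k := k) bf _ PM); first exact: measurable_partial_bump.
move=> x h; apply: (kab x 0%R); rewrite ?normr0// subr0.
by apply: contrapT => /(partial_bump_out i N0) /eqP; exact/negP.
Qed.

Lemma is_weak_partial_on_bumps i u v :
  is_weak_partial i u v -> weak_partial_on_bumps i u v.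
Proof.
move=> [[mu_ iu] [mv iv] H].
have sub k : @cube R n k `<=` cbox (fun=> - k%:R)%R (fun=> k%:R)%R.
  by move=> x xk j; have /andP[? ?] := xk j; rewrite /= in_itv/= !ltW.
have mcb (a b : 'I_n -> R) : measurable (cbox a b : set V).
  rewrite (_ : cbox a b = \bigcap_(j in [set: 'I_n])
      ((fun x : V => x ord0 j) @^-1` `[a j, b j]%classic)); last first.
    by apply/seteqP; split=> [x xab j _|x xab j]; [exact: xab|exact: (xab j I)].
  apply: fin_bigcap_measurable => // j _; rewrite -[X in measurable X]setTI.
  by apply: measurable_coord => //; exact: measurable_itv.
have boxint f : measurable_fun setT f ->
    (forall K, compact K -> mu.-integrable K (EFin \o f)) -> box_integrable f.
  move=> mf iK; split=> // k.
  apply: integrableS (iK _ (@compact_cbox _ _ (fun=> - k%:R)%R (fun=> k%:R)%R)) => //.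
  exact: measurable_box.
have bu := boxint _ mu_ iu; have bv := boxint _ mv iv.
split=> // N a b N0.
have i1 := box_integrable_partial i a b N0 bu.
have i2 := box_integrable_bump a b N0 bv.
have := H _ (test_function_bump a b N0); rewrite /Rintegral => E.
rewrite -[RHS]fineK ?(integrable_fin_num measurableT i2)// -[fine _]opprK -E EFinN.
rewrite fineK ?(integrable_fin_num measurableT i1)//.
rewrite -mulN1e -integralZl//; apply: eq_integral => x _.
by rewrite mulrN mulN1e.
Qed.

End weak_partial_bumps.

(** * Sliding along a segment *)

Section sliding.
Context {R : realType} (n : nat).
Local Notation V := 'rV[R]_n.
Local Notation mu := (@lebesgue_row R n).
Local Notation lam := (@lebesgue_measure R).
Variables (e : V) (t : R).
Hypotheses (t0 : (0 < t)%R) (e1 : (`|e| <= 1)%R).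
Local Open Scope ereal_scope.

(** The segment [0, t] as a weight, for use in [Lnorm_integral_le]. *)
Definition seg (tau : R) : R := \1_(`[0%R, t]%classic) tau.

Lemma seg_ge0 tau : (0 <= seg tau)%R. Proof. by []. Qed.

Lemma segE tau : seg tau = if (0 <= tau <= t)%R then 1%R else 0%R.
Proof. by rewrite /seg indicE mem_setE in_itv/=; case: ifP. Qed.

Lemma measurable_seg : measurable_fun setT seg.
Proof. exact: measurable_indic. Qed.

Lemma integral_seg : \int[lam]_tau (seg tau)%:E = t%:E.
Proof.
rewrite integral_indic// setIT [LHS]lebesgue_measure_itv/= lte_fin t0.
by rewrite -EFinD subr0.
Qed.

Lemma integral_seg_mul (F : R -> R) :
  \int[lam]_tau (seg tau * F tau)%:E = \int[lam]_(tau in `[0%R, t]) (F tau)%:E.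
Proof.
rewrite [RHS]integral_mkcond; apply: eq_integral => tau _.
rewrite patchE segE mem_setE in_itv/=.
by case: ifP; rewrite ?mul1r ?mul0r.
Qed.

Lemma measurable_slide (c : R) :
  measurable_fun setT (fun z : V * measurableTypeR R => (z.1 + (c * z.2) *: e)%R).
Proof.
apply: measurable_rowD; first exact: measurable_fst.
apply: measurable_rowZ => //; apply: measurable_funM => //; exact: measurable_snd.
Qed.

Section slide_kernels.
Variables (f beta : V -> R) (M : R) (k : nat).
Hypotheses (bf : box_integrable f) (mb : measurable_fun setT beta)
  (bM : forall x, (`|beta x| <= M)%R)
  (bk : forall x h : V, (`|h| <= t)%R -> beta (x - h)%R != 0%R -> cube n k x).

(** Integrands of the two sides of
    [\int f x * beta (x - tau e) = \int f (x + tau e) * beta x], with [tau] in the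
    segment: [slide_right] moves the test function, [slide_left] moves [f]. The
    function [beta] vanishes outside a cube even after sliding, so both are
    integrable in the pair [(x, tau)] and Fubini applies. *)
Definition slide_right (z : V * measurableTypeR R) : \bar R :=
  (seg z.2 * (f z.1 * beta (z.1 - z.2 *: e)))%:E%R.

Definition slide_left (z : V * measurableTypeR R) : \bar R :=
  (seg z.2 * (f (z.1 + z.2 *: e) * beta z.1))%:E%R.

Let mf : measurable_fun setT f. Proof. by case: bf. Qed.

Let mseg : measurable_fun setT (fun z : V * measurableTypeR R => seg z.2).
Proof. exact: measurableT_comp measurable_seg measurable_snd. Qed.

Let msub : measurable_fun setT (fun z : V * measurableTypeR R => (z.1 - z.2 *: e)%R).
Proof.
have := measurable_slide (-1)%R; congr measurable_fun; apply/funext => z.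
by rewrite mulN1r scaleNr.
Qed.

Let madd : measurable_fun setT (fun z : V * measurableTypeR R => (z.1 + z.2 *: e)%R).
Proof.
have := measurable_slide 1%R; congr measurable_fun; apply/funext => z.
by rewrite mul1r.
Qed.

Lemma measurable_slide_right : measurable_fun setT slide_right.
Proof.
apply/measurable_EFinP; apply: measurable_funM => //; apply: measurable_funM.
  exact: measurableT_comp mf measurable_fst.
exact: measurableT_comp mb msub.
Qed.

Lemma measurable_slide_left : measurable_fun setT slide_left.
Proof.
apply/measurable_EFinP; apply: measurable_funM => //; apply: measurable_funM.
  exact: measurableT_comp mf madd.
exact: measurableT_comp mb measurable_fst.
Qed.

Lemma integrable_slide_right : (mu \x lam).-integrable setT slide_right.
Proof.
have mck : measurable (@cube R n k) by exact: measurable_box.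
have [_ fk] := bf; have ik := (integrable_mkcond (EFin \o f) mck).1 (fk k).
have M0 : (0 <= M)%R by exact: le_trans (bM 0%R).
have mfk : measurable_fun setT (fun x => `|((EFin \o f) \_ (cube n k)) x|).
  by apply: measurableT_comp => //; case/integrableP: ik.
(* a product dominating the integrand *)
pose G (z : V * measurableTypeR R) : \bar R :=
  (M * seg z.2)%:E * `|((EFin \o f) \_ (cube n k)) z.1|.
have mG : measurable_fun setT G.
  apply: emeasurable_funM.
    by apply/measurable_EFinP; exact: measurable_funM.
  exact: (measurableT_comp mfk measurable_fst).
have G0 z : 0 <= G z by rewrite mule_ge0// lee_fin mulr_ge0.
apply: (@le_integrable _ _ _ _ setT measurableT _ G) => //.
- exact: measurable_slide_right.
- move=> z _; rewrite [leRHS]gee0_abs// /slide_right /G patchE segE.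
  case: ifP => [tau|_]; last by rewrite mul0r abse0; apply: mule_ge0; rewrite ?abse_ge0 ?lee_fin ?mulr0.
  rewrite mul1r mulr1; have [h0|h0] := eqVneq (beta (z.1 - z.2 *: e)%R) 0%R.
    by rewrite h0 mulr0 abse0; apply: mule_ge0; rewrite ?abse_ge0 ?lee_fin.
  have hz : (`|z.2 *: e| <= t)%R.
    have /andP[? ?] := tau.
    by rewrite normrZ ger0_norm// -[leRHS]mulr1 ler_pM.
  have zk := bk hz h0; rewrite ifT ?inE// abse_EFin normrM mulrC EFinM.
  by rewrite lee_wpmul2r// lee_fin.
- apply/integrable12ltyP => //.
  rewrite (eq_integral (fun x => (M * t)%:E * `|((EFin \o f) \_ (cube n k)) x|)).
    rewrite ge0_integralZl//; last by rewrite lee_fin mulr_ge0// ltW.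
    rewrite lte_mul_pinfty// ?lee_fin ?mulr_ge0 ?(ltW t0)//.
    by case/integrableP: ik.
  move=> x _.
  transitivity (\int[lam]_tau ((M * seg tau)%:E * `|((EFin \o f) \_ (cube n k)) x|)).
    by apply: eq_integral => tau _; rewrite gee0_abs.
  rewrite ge0_integralZr//; last 2 first.
  - by apply/measurable_EFinP; apply: measurable_funM => //; exact: measurable_seg.
  - by move=> tau _; rewrite lee_fin mulr_ge0.
  congr (_ * _); under eq_integral do rewrite EFinM.
  rewrite ge0_integralZl ?integral_seg ?EFinM//.
    by apply/measurable_EFinP; exact: measurable_seg.
  by move=> tau _; rewrite lee_fin seg_ge0.
Qed.

Lemma integral_slide tau :
  \int[mu]_x slide_left (x, tau) = \int[mu]_x slide_right (x, tau).
Proof.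
have ms := measurableT_comp measurable_slide_right (pair2_measurable (tau : measurableTypeR R)).
rewrite -(integral_translate (tau *: e)%R ms).
by apply: eq_integral => x _; rewrite /slide_right /slide_left/= addrK.
Qed.

Lemma integrable_slide_left : (mu \x lam).-integrable setT slide_left.
Proof.
apply/integrable21ltyP; first exact: measurable_slide_left.
have := (integrable21ltyP mu lam measurable_slide_right).1 integrable_slide_right.
congr (_ < _); apply: eq_integral => tau _.
have ms : measurable_fun setT (fun x : V => `|slide_right (x, tau)|).
  apply: measurableT_comp => //.
  exact: measurableT_comp measurable_slide_right (pair2_measurable (tau : measurableTypeR R)).
rewrite -(ge0_integral_translate (tau *: e)%R ms)//.
by apply: eq_integral => x _; rewrite /slide_right /slide_left/= addrK.
Qed.

End slide_kernels.

End sliding.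

(** * The fundamental theorem of calculus for weak derivatives *)

Section directional_ftc.
Context {R : realType} (n : nat).
Local Notation V := 'rV[R]_n.
Local Notation mu := (@lebesgue_row R n).
Local Notation lam := (@lebesgue_measure R).
Implicit Types (u v : V -> R) (i : 'I_n).
Local Open Scope ereal_scope.

Lemma norm_delta_le1 i : (`|delta_mx ord0 i : V| <= 1)%R.
Proof.
apply: norm_row_le => // j; rewrite mxE eqxx/=.
by case: (_ == _); rewrite ?normr1 ?normr0.
Qed.

(** The classical fundamental theorem along the i-th axis, where only the i-th
    factor of the bump varies. *)
Lemma bump_ftc (N : R) (a b : 'I_n -> R) i (t : R) (x : V) : (0 < t)%R ->
  \int[lam]_tau (seg t tau * - partial i (bumpf N a b) (x - tau *: delta_mx ord0 i))%:E =
  (bumpf N a b (x - t *: delta_mx ord0 i) - bumpf N a b x)%:E.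
Proof.
move=> t0; rewrite (integral_seg_mul t (fun tau => - partial i _ (x - tau *: _))%R).
set e := delta_mx _ _.
pose c := (\prod_(j < n | j != i) bump1 N (a j) (b j) (x ord0 j))%R.
have oth tau : (\prod_(j < n | j != i) bump1 N (a j) (b j) ((x - tau *: e) ord0 j) = c)%R.
  by apply: eq_bigr => j ji; rewrite !mxE (negbTE ji) andbF mulr0 subr0.
have own tau : ((x - tau *: e) ord0 i = x ord0 i - tau)%R.
  by rewrite !mxE !eqxx mulr1.
pose F tau := bumpf N a b (x - tau *: e)%R.
pose G tau := (bump1 N (a i) (b i) (x ord0 i - tau) * c)%R.
have FG : F = G.
  by apply/funext => tau; rewrite /F /G /bumpf (bigD1 i)//= oth own.
have dG (tau : R) : (is_derive tau 1 G (- (dbump1 N (a i) (b i) (x ord0 i - tau) * c)))%R.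
  pose L (s : R) := (x ord0 i - s)%R.
  have d1 : (is_derive tau 1 L (-1))%R.
    rewrite (_ : L = (fun s => -1 * s + x ord0 i)%R).
      by apply: is_derive_eq; rewrite addr0 /=; exact: mulr1.
    by apply/funext => s; rewrite /L; ring.
  have d2 := is_derive1_comp (is_derive_bump1 N (a i) (b i) (L tau)) d1.
  have dc : (is_derive tau 1 (fun _ : R => c) 0)%R by exact: is_derive_cst.
  apply: (is_derive_eq (is_deriveM d2 dc)).
  by rewrite scaler0 add0r /GRing.scale/= /L; ring.
have dF (tau : R) : (is_derive tau 1 F (- partial i (bumpf N a b) (x - tau *: e)))%R.
  by rewrite FG partial_bumpE oth own.
have cF : continuous F.
  move=> tau; apply: differentiable_continuous; apply/derivable1_diffP.
  by have [] := dF tau.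
have cdF : continuous (fun tau : R => - partial i (bumpf N a b) (x - tau *: e))%R.
  have E : (fun tau : R => - partial i (bumpf N a b) (x - tau *: e))%R =
      (fun tau : R => - (dbump1 N (a i) (b i) (x ord0 i - tau) * c))%R.
    by apply/funext => tau; rewrite partial_bumpE oth own.
  rewrite E => tau.
  have c1 (P : {poly R}) (p q : R) : continuous (fun tau : R => flat P (p * tau + q))%R.
    move=> s; apply: (continuous_comp (f := fun tau : R => p * tau + q)%R);
      last exact: continuous_flat.
    have id_ : (fun z : R => z) @ s --> s by exact: cvg_id.
    exact: (cvgD (cvgM (cvg_cst p) id_) (cvg_cst q)).
  have cl (P : {poly R}) : continuous (fun tau : R => flat P (N * (x ord0 i - tau - a i)))%R.
    rewrite (_ : (fun tau : R => _) = (fun tau : R => flat P (- N * tau + N * (x ord0 i - a i)))%R).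
      exact: c1.
    by apply/funext => s; congr flat; ring.
  have cr (P : {poly R}) : continuous (fun tau : R => flat P (N * (b i - (x ord0 i - tau))))%R.
    rewrite (_ : (fun tau : R => _) = (fun tau : R => flat P (N * tau + N * (b i - x ord0 i)))%R).
      exact: c1.
    by apply/funext => s; congr flat; ring.
  exact: (cvgN (cvgM (cvgB (cvgM (cvgM (cvg_cst N) (cl _ tau)) (cr _ tau))
    (cvgM (cvgM (cvg_cst N) (cl _ tau)) (cr _ tau))) (cvg_cst c))).
rewrite (@continuous_FTC2 _ _ F 0%R t t0).
- by rewrite -EFinB /F scale0r subr0.
- exact: continuous_subspaceT.
- split.
  + by move=> tau _; have [] := dF tau.
  + by apply: cvg_at_right_filter; exact: cF.
  + by apply: cvg_at_left_filter; exact: cF.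
- by move=> tau _; rewrite derive1E; have [_ ->] := dF tau.
Qed.

Variables (i : 'I_n) (u v : V -> R) (t : R).
Hypotheses (t0 : (0 < t)%R) (uv : weak_partial_on_bumps i u v).

Let e : V := delta_mx ord0 i.

(** The integral of the candidate derivative over the segment from [x] to
    [x + t e]. It is finite for almost every [x] only, hence the [fine]. *)
Definition line_mean (x : V) : R :=
  fine (\int[lam]_tau (seg t tau * v (x + tau *: e))%:E).

Let mv : measurable_fun setT v. Proof. by case: uv => _ []. Qed.
Let mu_ : measurable_fun setT u. Proof. by case: uv => [[]]. Qed.

Let mline : measurable_fun setT
  (fun z : V * measurableTypeR R => (seg t z.2 * v (z.1 + z.2 *: e))%:E%R).
Proof.
apply/measurable_EFinP; apply: measurable_funM.
  exact: measurableT_comp (measurable_seg t) measurable_snd.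
apply: (measurableT_comp mv).
have := measurable_slide (n := n) e 1%R; congr measurable_fun; apply/funext => z.
by rewrite mul1r.
Qed.

Lemma measurable_line_mean : measurable_fun setT line_mean.
Proof.
apply: (@measurableT_comp _ _ _ _ _ _ (@fine R)); first exact: fine_measurable.
exact: measurable_fun_integral2 mline.
Qed.

Lemma line_mean_le (x : V) :
  `|(line_mean x)%:E| <= \int[lam]_tau (seg t tau * `|v (x + tau *: e)|)%:E.
Proof.
have mx := measurableT_comp mline (pair1_measurable x).
have le1 : `| \int[lam]_tau (seg t tau * v (x + tau *: e))%:E | <=
    \int[lam]_tau (seg t tau * `|v (x + tau *: e)|)%:E.
  apply: le_trans (le_abse_integral _ measurableT mx) _.
  rewrite le_eqVlt; apply/orP; left; apply/eqP; apply: eq_integral => tau _ /=.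
  by rewrite normrM ger0_norm.
apply: le_trans le1; rewrite /line_mean.
by case: (\int[lam]_tau _) => [r| |] //=; rewrite ?normr0 ?leey.
Qed.

Lemma box_integrable_line_mean : box_integrable line_mean.
Proof.
split=> [|k]; first exact: measurable_line_mean.
have [_ bv _] := uv.
have [K hK] := @box_sub_cube R n (fun=> - k%:R)%R (fun=> k%:R)%R t.
have mck : measurable (@cube R n k) by exact: measurable_box.
pose beta : V -> R := \1_(cube n k).
have mb : measurable_fun setT beta by exact: measurable_indic.
have b1 x : (`|beta x| <= 1)%R by rewrite ger0_norm// /beta indicE; case: (_ \in _).
have bK (x h : V) : (`|h| <= t)%R -> beta (x - h)%R != 0%R -> cube n K x.
  move=> ht; rewrite /beta indicE; case: (boolP (_ \in _)) => [|_]; last by rewrite eqxx.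
  by rewrite inE => + _; exact: hK.
have I := integrable_slide_left t0 (norm_delta_le1 i) bv mb b1 bK.
have := (integrable12ltyP mu lam (measurable_slide_left _ _ bv mb)).1 I.
move=> H; apply/integrableP; split.
  by apply/measurable_EFinP; apply: measurable_funTS; exact: measurable_line_mean.
apply: le_lt_trans H; rewrite integral_mkcond; apply: ge0_le_integral => //.
- by move=> x _; apply: erestrict_ge0.
- apply/(measurable_restrictT _ _).1 => //; apply: measurable_funTS.
  by apply: measurableT_comp => //; apply/measurable_EFinP; exact: measurable_line_mean.
- apply: (measurable_fun_fubini_tonelli_F (m2 := lam) (fun z => `|slide_left e t v beta z|)) => //.
  by apply: measurableT_comp => //; exact: measurable_slide_left.
- move=> x _; rewrite patchE; case: ifPn => xk; last exact: integral_ge0.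
  apply: le_trans (line_mean_le x) _.
  rewrite le_eqVlt; apply/orP; left; apply/eqP; apply: eq_integral => tau _ /=.
  by rewrite /beta indicE xk mulr1 normrM (ger0_norm (seg_ge0 _ _)).
Qed.

(** Test both sides against a bump [phi]. Moving the translation onto [phi], the
    left side becomes the integral of [u x * (phi (x - t e) - phi x)], and by
    [bump_ftc] a double integral of [u] against [- partial phi] at
    [x - tau e]. For fixed [tau] this is the integral of [v] against a translate
    of [phi], and sliding back gives [line_mean]. *)
Lemma weak_directional_ftc :
  {ae mu, forall x : V, u (x + t *: e) - u x = line_mean x}%R.
Proof.
have [bu bv H] := uv.
have bg := box_integrable_line_mean.
suff : {ae mu, forall x : V, u (x + t *: e) - u x - line_mean x = 0}%R.
  by apply: filterS => x /eqP; rewrite subr_eq0 => /eqP.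
have nte : (`|t *: e| <= t)%R.
  by rewrite normrZ gtr0_norm// -[leRHS]mulr1 ler_wpM2l ?(ltW t0)// norm_delta_le1.
have but := box_integrable_translate (t *: e)%R bu.
have bf : box_integrable (fun x : V => u (x + t *: e) - u x - line_mean x)%R.
  split=> [|k].
    apply: measurable_funB; last exact: measurable_line_mean.
    by apply: measurable_funB => //; case: but.
  have mck : measurable (@cube R n k) by exact: measurable_box.
  have [_ hut] := but; have [_ hu] := bu; have [_ hg] := bg.
  exact: (integrableB mck (integrableB mck (hut k) (hu k)) (hg k)).
apply: fundamental_lemma bf _ => N a b N0.
set phi := bumpf N a b.
have [K hK] := box_sub_cube a b t.
have mphi : measurable_fun setT phi by exact: measurable_bump.
have phi1 x : (`|phi x| <= 1)%R by have /andP[? ?] := bump_01 N a b x; rewrite ger0_norm.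
have phiK (x h : V) : (`|h| <= t)%R -> phi (x - h)%R != 0%R -> cube n K x.
  move=> ht h0; apply: (hK x h) => //.
  by apply: contrapT => /(bump_out N0) /eqP; exact/negP.
have [M PM] := partial_bump_bounded i a b N0.
have mbeta : measurable_fun setT (\- partial i phi)%R.
  by apply: measurable_funN; exact: measurable_partial_bump.
have betaM x : (`|(\- partial i phi) x| <= M)%R by rewrite normrN.
have betaK (x h : V) : (`|h| <= t)%R -> (\- partial i phi)%R (x - h)%R != 0%R -> cube n K x.
  rewrite oppr_eq0 => ht h0; apply: (hK x h) => //.
  by apply: contrapT => /(partial_bump_out i N0) /eqP; exact/negP.
have I1 := integrable_slide_right t0 (norm_delta_le1 i) bu mbeta betaM betaK.
have I3 := integrable_slide_left t0 (norm_delta_le1 i) bv mphi phi1 phiK.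
(* the weak derivative, tested on phi translated by tau e *)
have E1 tau : \int[mu]_x slide_right e t u (\- partial i phi)%R (x, tau) =
    \int[mu]_x slide_right e t v phi (x, tau).
  rewrite /slide_right /= segE; case: ifP => _; last first.
    by rewrite !integral0_eq// => x _; rewrite mul0r.
  have := H N (fun j => a j + (tau *: e) ord0 j)%R (fun j => b j + (tau *: e) ord0 j)%R N0.
  under eq_integral do rewrite -partial_bump_shift.
  under [RHS]eq_integral do rewrite -bump_shift.
  move=> E; under [LHS]eq_integral do rewrite mul1r.
  by under [RHS]eq_integral do rewrite mul1r.
(* integrating over the segment first *)
have E2 x : \int[lam]_tau slide_right e t u (\- partial i phi)%R (x, tau) =
    (u x * (phi (x - t *: e)%R - phi x))%:E.
  have mx : measurable_fun setT (fun tau : measurableTypeR R => x - tau *: e)%R.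
    under eq_fun do rewrite -scaleNr.
    by apply: measurable_rowD => //; apply: measurable_rowZ => //; exact: measurable_funN.
  have Ix : lam.-integrable setT
      (fun tau => (seg t tau * - partial i phi (x - tau *: e)%R)%:E).
    apply: (@le_integrable _ (measurableTypeR R) R lam setT measurableT _ (fun tau => M%:E * (seg t tau)%:E)).
    - apply/measurable_EFinP; apply: measurable_funM; first exact: measurable_seg.
      exact: (measurableT_comp mbeta mx).
    - move=> tau _; rewrite -EFinM !abse_EFin lee_fin !normrM normrN mulrC.
      by rewrite ler_wpM2r// (le_trans (PM _))// ler_norm.
    - by apply: integrableZl => //; exact: integrable_indic_itv.
  rewrite EFinM -bump_ftc// -integralZl//.
  by apply: eq_integral => tau _; rewrite /slide_right/= -EFinM mulrCA.
have E3 : {ae mu, forall x, \int[lam]_tau slide_left e t v phi (x, tau) =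
    (line_mean x * phi x)%:E}.
  apply: filterS (ae_integrable1 I3) => x Ix.
  have [p0|p0] := eqVneq (phi x) 0%R.
    by rewrite p0 mulr0; apply: integral0_eq => tau _; rewrite /slide_left/= p0 !mulr0.
  have Jx : lam.-integrable setT (fun tau => (seg t tau * v (x + tau *: e)%R)%:E).
    have := integrableZl measurableT (phi x)^-1 Ix.
    apply: eq_integrable => // tau _; rewrite /slide_left/= -EFinM; congr EFin.
    by rewrite mulrC -!mulrA mulfV// mulr1.
  rewrite /line_mean mulrC EFinM fineK ?(integrable_fin_num measurableT Jx)//.
  rewrite -integralZl//; apply: eq_integral => tau _.
  by rewrite /slide_left/= -EFinM mulrA mulrC.
have gphi : mu.-integrable setT (fun x => (line_mean x * phi x)%:E).
  exact: box_integrable_bump.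
have main : \int[mu]_x (u x * (phi (x - t *: e)%R - phi x))%:E =
    \int[mu]_x (line_mean x * phi x)%:E.
  under eq_integral do rewrite -E2.
  rewrite (Fubini I1).
  transitivity (\int[lam]_tau \int[mu]_x slide_left e t v phi (x, tau)).
    apply: eq_integral => tau _; by rewrite E1; apply/esym/integral_slide.
  rewrite -(Fubini I3); apply: ae_eq_integral => //.
  - by apply: measurable_fun_integral2; exact: measurable_slide_left.
  - by case/integrableP: gphi.
  - by apply: filterS E3 => x Ex _.
have up : mu.-integrable setT (fun x => (u x * phi x)%:E) by exact: box_integrable_bump.
have utp : mu.-integrable setT (fun x : V => (u (x + t *: e)%R * phi x)%:E).
  exact: (box_integrable_bump a b N0 but).
have upt : mu.-integrable setT (fun x : V => (u x * phi (x - t *: e)%R)%:E).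
  by rewrite /phi; under eq_fun do rewrite bump_shift; exact: box_integrable_bump.
have main2 : \int[mu]_x (u x * (phi (x - t *: e)%R - phi x))%:E =
  \int[mu]_x (u (x + t *: e)%R * phi x)%:E - \int[mu]_x (u x * phi x)%:E.
  under eq_integral do rewrite mulrBr EFinB.
  rewrite integralB_EFin//; congr (_ - _).
  have mupt : measurable_fun setT (fun x : V => (u x * phi (x - t *: e)%R)%:E).
    by case/integrableP: upt.
  rewrite -(integral_translate (t *: e)%R mupt).
  by apply: eq_integral => x _; rewrite addrK.
under eq_integral do rewrite !mulrBl !EFinB.
rewrite integralB_EFin//; last exact: (integrableB measurableT utp up).
rewrite integralB_EFin// -main2 main subee//.
exact: integrable_fin_num.
Qed.

End directional_ftc.

(** * Differences of first and second order *)

Section first_order.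
Context {R : realType} (n : nat).
Local Notation V := 'rV[R]_n.
Local Notation mu := (@lebesgue_row R n).
Local Notation lam := (@lebesgue_measure R).
Implicit Types (u v : V -> R) (i : 'I_n) (p : \bar R) (h : V).
Local Open Scope ereal_scope.

Lemma sume_const (X : \bar R) : 0 <= X -> \sum_(i < n) X = n%:R%:E * X.
Proof.
move=> X0; transitivity (\sum_(i < n) 1%:E * X).
  by apply: eq_bigr => i _; rewrite mul1e.
by rewrite -ge0_sume_distrl// sumEFin sumr_const card_ord.
Qed.

(** Minkowski's inequality applied to the average over the segment in
    [weak_directional_ftc]. *)
Lemma Lnorm_shift_diff_delta i u v (t : R) p : 1 <= p ->
  weak_partial_on_bumps i u v ->
  'N[mu]_p[EFin \o shift_diff (t *: delta_mx ord0 i)%R u] <=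
  `|t|%:E * 'N[mu]_p[EFin \o v].
Proof.
move=> p1 uv; have [[mu_ _] [mv _] _] := uv.
wlog t0 : t / (0 < t)%R.
  move=> H; have [t0|t0|<-] := ltgtP 0%R t; first exact: H.
    rewrite -[t]opprK scaleNr normrN Lnorm_shift_diffN//.
    by apply: H; rewrite oppr_gt0.
  rewrite scale0r normr0 mul0e; apply: (@le_trans _ _ 'N[mu]_p[cst 0]); last first.
    by rewrite Lnorm0// gt_eqF// (lt_le_trans _ p1).
  apply: le_Lnorm => //.
    by apply/measurable_EFinP; exact: measurable_shift_diff.
  by apply: nearW => x; rewrite /shift_diff/= addr0 subrr.
set e := delta_mx ord0 i.
pose k (z : V * measurableTypeR R) : R := v (z.1 + z.2 *: e)%R.
have mk : measurable_fun setT k.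
  apply: (measurableT_comp mv); have := measurable_slide (n := n) e 1%R.
  by congr measurable_fun; apply/funext => z; rewrite mul1r.
have mg : measurable_fun setT (seg t : measurableTypeR R -> R) by exact: measurable_seg.
have N0 : 0 <= 'N[mu]_p[EFin \o v] by exact: Lnorm_ge0.
have kA (tau : measurableTypeR R) : seg t tau != 0%R ->
    'N[mu]_p[(fun x => (k (x, tau))%:E)] <= 'N[mu]_p[EFin \o v].
  move=> _; rewrite -(Lnorm_translate (tau *: e)%R p1 (_ : measurable_fun setT (EFin \o v)))//.
  exact/measurable_EFinP.
have := Lnorm_integral_le p1 mg mk (seg_ge0 t) (integral_seg t0) N0 kA.
rewrite gtr0_norm//; apply: le_trans; apply: le_Lnorm => //.
- by apply/measurable_EFinP; exact: measurable_shift_diff.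
- apply: (measurable_fun_fubini_tonelli_F (m2 := lam) (fun z => (seg t z.2 * `|k z|)%:E)).
    apply/measurable_EFinP; apply: measurable_funM; last exact: measurableT_comp.
    exact: (measurableT_comp mg measurable_snd).
  by move=> z; rewrite lee_fin mulr_ge0.
- apply: filterS (weak_directional_ftc t0 uv) => x Ex.
  have := line_mean_le t uv x; rewrite -Ex => h.
  exact: le_trans h (lee_abs _).
Qed.

(** Go from [x] to [x + h] along the coordinate axes, one at a time. *)
Lemma Lnorm_shift_diff_weak_partials (v : 'I_n -> V -> R) u h (r : R) p : 1 <= p ->
  (forall i, weak_partial_on_bumps i u (v i)) -> measurable_fun setT u ->
  (`|h| <= r)%R ->
  'N[mu]_p[EFin \o shift_diff h u] <= \sum_(i < n) r%:E * 'N[mu]_p[EFin \o v i].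
Proof.
move=> p1 uv mu_ hr.
rewrite [X in shift_diff X](row_sum_delta h).
elim: (index_enum _) => [|i s IH].
  rewrite !big_nil; apply: (@le_trans _ _ 'N[mu]_p[cst 0]); last first.
    by rewrite Lnorm0// gt_eqF// (lt_le_trans _ p1).
  apply: le_Lnorm => //.
    by apply/measurable_EFinP; exact: measurable_shift_diff.
  by apply: nearW => x; rewrite /shift_diff/= addr0 subrr.
rewrite !big_cons; apply: le_trans (Lnorm_shift_diffD _ _ p1 mu_) _.
apply: leeD => //; apply: le_trans (Lnorm_shift_diff_delta _ p1 (uv i)) _.
rewrite lee_wpmul2r ?Lnorm_ge0// lee_fin.
exact: le_trans (coord_le_norm h i) hr.
Qed.

Lemma weak_partial_on_bumps_shift_diff i u v h :
  weak_partial_on_bumps i u v ->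
  weak_partial_on_bumps i (shift_diff h u) (shift_diff h v).
Proof.
move=> [bu bv H].
have buh := box_integrable_translate h bu; have bvh := box_integrable_translate h bv.
have boxB f g : box_integrable f -> box_integrable g ->
    box_integrable (fun x : V => f x - g x)%R.
  move=> [mf If] [mg Ig]; split=> [|k]; first exact: measurable_funB.
  have mck : measurable (@cube R n k) by exact: measurable_box.
  exact: (integrableB mck (If k) (Ig k)).
split=> [||N a b N0]; [exact: boxB|exact: boxB|].
have Ip f : box_integrable f ->
    mu.-integrable setT (fun x => (f x * - partial i (bumpf N a b) x)%:E).
  move=> bf; have := integrableN (box_integrable_partial i a b N0 bf).
  by apply: eq_integrable => // x _; rewrite mulrN.
have Ib f : box_integrable f ->
    mu.-integrable setT (fun x => (f x * bumpf N a b x)%:E).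
  by move=> bf; exact: box_integrable_bump.
rewrite /shift_diff.
under eq_integral do rewrite mulrBl EFinB.
under [RHS]eq_integral do rewrite mulrBl EFinB.
rewrite (integralB_EFin measurableT (Ip _ buh) (Ip _ bu)).
rewrite (integralB_EFin measurableT (Ib _ bvh) (Ib _ bv)).
congr (_ - _); last exact: H.
have shiftE (f g : V -> R) : measurable_fun setT f -> measurable_fun setT g ->
    \int[mu]_x (f (x + h)%R * g x)%:E = \int[mu]_x (f x * g (x - h)%R)%:E.
  move=> mf mg.
  have m : measurable_fun setT (fun x : V => (f x * g (x - h)%R)%:E).
    apply/measurable_EFinP; apply: measurable_funM => //.
    exact: measurableT_comp mg (measurable_translate (- h)%R).
  rewrite -(integral_translate h m).
  by apply: eq_integral => x _; rewrite addrK.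
have mu_ : measurable_fun setT u by case: bu.
have mv : measurable_fun setT v by case: bv.
rewrite (shiftE u (\- partial i (bumpf N a b))%R mu_); last first.
  by apply: measurable_funN; exact: measurable_partial_bump.
rewrite (shiftE v (bumpf N a b) mv); last exact: measurable_bump.
under eq_integral do rewrite /= partial_bump_shift.
under [RHS]eq_integral do rewrite bump_shift.
exact: H.
Qed.

Lemma weak_partialP i u :
  (exists v, is_weak_partial i u v) -> is_weak_partial i u (weak_partial i u).
Proof. by move=> [v uv]; exact: (@xgetPex _ (cst 0%R) [set v | is_weak_partial i u v] (ex_intro _ v uv)). Qed.

Lemma seminorm01_ge0 (s : R) p u : 1 <= p -> 0 <= seminorm01 s p u.
Proof.
move=> p1; rewrite /seminorm01; case: eqVneq => _; first exact: Lnorm_ge0.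
case: eqVneq => _; first by case: asboolP => _; rewrite ?Lnorm_ge0// leey.
case: p p1 => [p| |]// _; first exact: poweR_ge0.
exact: gagliardo_y_ge0.
Qed.

(** The three regimes [s = 0], [s = 1] and [0 < s < 1] have different proofs;
    [gainC n] dominates all their constants. *)
Lemma Lnorm_shift_diff_seminorm01 (s : R) p u h (r : R) : (0 < n)%N ->
  (0 <= s <= 1)%R -> 1 <= p -> measurable_fun setT u -> (0 < r)%R -> (`|h| <= r)%R ->
  'N[mu]_p[EFin \o shift_diff h u] <= (gainC n * r `^ s)%:E * seminorm01 s p u.
Proof.
move=> hn /andP[s0 s1] p1 mu_ r0 hr.
have C0 := gainC_gt0 (R := R) hn.
have nC := gainC_ge_dim (R := R) hn; have C2 := gainC_ge2 (R := R) hn.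
rewrite /seminorm01; case: eqVneq => [->|sn0].
  rewrite powRr0 mulr1; apply: le_trans (Lnorm_shift_diff_le2 _ p1 mu_) _.
  by rewrite lee_wpmul2r ?Lnorm_ge0// lee_fin.
case: eqVneq => [->|sn1].
  have CD : (0 < gainC n * r `^ 1)%R by rewrite mulr_gt0 ?powR_gt0.
  case: asboolP => [wd|_]; last by rewrite gt0_muley ?lte_fin// leey.
  have uv i := is_weak_partial_on_bumps (weak_partialP (wd i)).
  apply: le_trans (Lnorm_shift_diff_weak_partials p1 uv mu_ hr) _.
  apply: (@le_trans _ _ (\sum_(i < n) r%:E * 'N[mu]_p[EFin \o (@enorm R n \o weak_grad u)])).
    apply: lee_sum => i _; rewrite lee_wpmul2l ?lee_fin ?(ltW r0)//.
    apply: le_Lnorm => //.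
    - by apply/measurable_EFinP; have [_ [? _] _] := uv i.
    - apply/measurable_EFinP; apply: (measurableT_comp (@measurable_enorm R n)).
      apply: measurable_fun_row => j; rewrite /weak_grad; under eq_fun do rewrite mxE.
      by have [_ [? _] _] := uv j.
    - apply: nearW => x /=; rewrite lee_fin [leRHS]ger0_norm ?enorm_ge0//.
      apply: le_trans (norm_le_enorm _); apply: le_trans _ (coord_le_norm _ i).
      by rewrite mxE.
  rewrite sume_const ?mule_ge0 ?Lnorm_ge0 ?lee_fin ?(ltW r0)// muleA -EFinM.
  rewrite powRr1 ?(ltW r0)//.
  by rewrite lee_wpmul2r ?Lnorm_ge0// lee_fin ler_wpM2r// ltW.
have s01 : (0 < s < 1)%R by rewrite !lt_neqAle s0 s1 sn1 eq_sym sn0.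
case: p p1 => [p| |]// p1; last exact: Lnorm_shift_diff_y.
exact: Lnorm_shift_diff_gagliardo.
Qed.

Definition second_diff h u : V -> R := fun x => (u (x + h) + u (x - h) - 2 * u x)%R.

(** Up to sign, a second difference is a difference of step [h] of a difference
    of step [- h]. The outer one costs [r] and a weak derivative of the inner
    one; the latter is a difference of the weak derivative of [u], of order
    [s - 1]. *)
Lemma Lnorm_second_diff (s : R) p u h (r : R) : (0 < n)%N ->
  (1 < s <= 2)%R -> 1 <= p -> measurable_fun setT u -> weakly_differentiable u ->
  (0 < r)%R -> (`|h| <= r)%R ->
  'N[mu]_p[EFin \o second_diff h u] <=
  (n%:R * gainC n * r `^ s)%:E * seminorm s p u.
Proof.
move=> hn /andP[s1 s2] p1 mu_ wd r0 hr.
have C0 := gainC_gt0 (R := R) hn.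
have uv i := is_weak_partial_on_bumps (weak_partialP (wd i)).
have mv i : measurable_fun setT (weak_partial i u) by have [_ [? _] _] := uv i.
have -> : 'N[mu]_p[EFin \o second_diff h u] =
    'N[mu]_p[EFin \o shift_diff h (shift_diff (- h)%R u)].
  rewrite -oppe_Lnorm; apply: eq_Lnorm => x; rewrite /= /second_diff /shift_diff addrK.
  by congr EFin; ring.
have hr' : (`|- h| <= r)%R by rewrite normrN.
apply: le_trans (Lnorm_shift_diff_weak_partials p1
  (fun i => weak_partial_on_bumps_shift_diff (- h)%R (uv i)) _ hr) _.
  exact: measurable_shift_diff.
rewrite /seminorm ifF; last by apply/negbTE; rewrite -ltNge.
set S := \big[Order.max/-oo]_(i < n) _.
have leS i : seminorm01 (s - 1)%R p (weak_partial i u) <= S.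
  exact: (le_bigmax -oo (fun i => seminorm01 (s - 1)%R p (weak_partial i u)) i).
have S0 : 0 <= S by apply: le_trans (leS (Ordinal hn)); exact: seminorm01_ge0.
apply: (@le_trans _ _ (\sum_(i < n) r%:E * ((gainC n * r `^ (s - 1))%:E * S))).
  apply: lee_sum => i _; rewrite lee_wpmul2l ?lee_fin ?(ltW r0)//.
  apply: le_trans (Lnorm_shift_diff_seminorm01 (s := (s - 1)%R) hn _ p1 (mv i) r0 hr') _.
    by rewrite subr_ge0 (ltW s1) lerBlDr.
  by rewrite lee_wpmul2l ?lee_fin ?mulr_ge0 ?powR_ge0 ?(ltW C0).
rewrite sume_const ?mule_ge0 ?lee_fin ?mulr_ge0 ?powR_ge0 ?(ltW r0) ?(ltW C0)//.
rewrite !muleA -!EFinM.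
rewrite (_ : n%:R * r * (gainC n * r `^ (s - 1)) = n%:R * gainC n * r `^ s)%R//.
rewrite -[(r `^ s)%R](mulr_powRB1 (ltW r0) (lt_trans ltr01 s1)); ring.
Qed.

End first_order.

(** * The error of a convolution *)

Section convolution_error.
Context {R : realType} (n : nat).
Local Notation V := 'rV[R]_n.
Local Notation mu := (@lebesgue_row R n).
Implicit Types (u k rho : V -> R) (p : \bar R) (h x y : V).
Local Open Scope ereal_scope.

(** Used to discard the points where the average of [|shift_diff y u|] is
    infinite: there the two halves of a second difference cannot be integrated
    separately. *)
Lemma Lnorm_lty_ae p (f : V -> \bar R) : 1 <= p -> measurable_fun setT f ->
  'N[mu]_p[f] < +oo -> {ae mu, forall x, `|f x| < +oo}.
Proof.
case: p => [p| |]//; rewrite ?lee_fin => p1 mf foo; last first.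
  apply: filterS (Lnorm_y_ae (@lebesgue_row_gt0 R n) (lexx 'N[mu]_+oo[f])) => x fx.
  exact: le_lt_trans fx foo.
have p0 : (0 < p)%R by exact: lt_le_trans p1.
have mfp := measurable_abs_poweR p mf.
have /integrable_ae : mu.-integrable setT (fun x => `|f x| `^ p).
  apply/integrableP; split => //.
  under eq_integral do rewrite gee0_abs ?poweR_ge0//.
  by rewrite -poweR_Lnorm ?gt_eqF// poweR_lty.
move=> /(_ measurableT); apply: filterS => x /(_ I); case: (f x) => [r| |]//=.
  by rewrite ltry.
all: by rewrite gt_eqF.
Qed.

Lemma ge0_integral_rescale (e : R) (f : V -> \bar R) : (0 < e)%R ->
  measurable_fun setT f -> (forall x, 0 <= f x) ->
  \int[mu]_x ((e ^- n)%:E * f (e^-1 *: x)%R) = \int[mu]_x f x.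
Proof.
move=> e0 mf f0.
have en : (0 <= e ^- n)%R by rewrite invr_ge0 exprn_ge0 ?ltW.
have e1 : (e^-1 != 0)%R by rewrite invr_neq0// gt_eqF.
rewrite [RHS](ge0_integral_affine 0%R e1 mf f0).
rewrite ger0_norm ?invr_ge0 ?(ltW e0)// exprVn.
rewrite -[RHS]ge0_integralZl//.
- by apply: eq_integral => x _; rewrite addr0.
- exact: measurableT_comp mf (measurable_affine _ _).
Qed.

Lemma measurable_rescale rho (e : R) : measurable_fun setT rho ->
  measurable_fun setT (rescale rho e).
Proof.
move=> mr; apply: measurable_funM => //.
have := measurableT_comp mr (measurable_affine e^-1 0); congr measurable_fun.
by apply/funext => x /=; rewrite addr0.
Qed.

Lemma integral_norm_rescale rho (e : R) : (0 < e)%R -> measurable_fun setT rho ->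
  \int[mu]_x `|rescale rho e x|%:E = \int[mu]_x `|rho x|%:E.
Proof.
move=> e0 mr; rewrite -(ge0_integral_rescale (f := fun x => `|rho x|%:E) e0)//; last first.
  by apply/measurable_EFinP; exact: measurableT_comp.
apply: eq_integral => x _; rewrite /rescale normrM EFinM ger0_norm//.
by rewrite invr_ge0 exprn_ge0 ?ltW.
Qed.

Lemma integral_rescale rho (e : R) : (0 < e)%R -> measurable_fun setT rho ->
  \int[mu]_x (rescale rho e x)%:E = \int[mu]_x (rho x)%:E.
Proof.
move=> e0 /measurable_EFinP mr; rewrite [LHS]integralE [RHS]integralE.
have en : (0 <= e ^- n)%R by rewrite invr_ge0 exprn_ge0 ?ltW.
congr (_ - _).
  rewrite -[RHS](ge0_integral_rescale e0 (measurable_funepos mr) (fun=> funepos_ge0 _ _)).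
  apply: eq_integral => x _; rewrite !funeposE /= -!EFin_max -EFinM.
  by rewrite /rescale maxr_pMr// mulr0.
rewrite -[RHS](ge0_integral_rescale e0 (measurable_funeneg mr) (fun=> funeneg_ge0 _ _)).
apply: eq_integral => x _; rewrite !funenegE /= -!EFin_max -EFinM.
by rewrite /rescale maxr_pMr// mulr0 mulrN.
Qed.

Lemma rescale_neq0 rho (e : R) y : (0 < e)%R -> supp rho = @unit_ball R n ->
  rescale rho e y != 0%R -> (`|y| <= e)%R.
Proof.
move=> e0 sr; rewrite /rescale mulf_eq0 negb_or => /andP[_ ry].
have : @unit_ball R n (e^-1 *: y)%R by rewrite -sr; exact: subset_closure.
move/(le_trans (norm_le_enorm _)).
by rewrite normrZ normfV gtr0_norm// mulrC ler_pdivrMr// mul1r.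
Qed.

Section kernel.
Variables (k : V -> R) (M : R).
Hypotheses (mk : measurable_fun setT k)
  (k1 : \int[mu]_y (k y)%:E = 1) (kM : \int[mu]_y `|k y|%:E = M%:E).

Let ki : mu.-integrable setT (EFin \o k).
Proof.
apply/integrableP; split; first exact/measurable_EFinP.
by rewrite [X in X < _](_ : _ = M%:E) ?ltry// -kM; apply: eq_integral.
Qed.

Lemma convolE u x : measurable_fun setT u ->
  convol k u x = fine (\int[mu]_y (k y * u (x - y)%R)%:E).
Proof.
move=> mu_; rewrite /convol /Rintegral.
rewrite -(integral_reflect x (f := fun y => (k y * u (x - y)%R)%:E)).
  by congr fine; apply: eq_integral => y _; rewrite subKr.
apply/measurable_EFinP; apply: measurable_funM => //.
exact: measurableT_comp mu_ (measurable_reflect x).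
Qed.

Lemma measurable_convol u : measurable_fun setT u ->
  measurable_fun setT (convol k u).
Proof.
move=> mu_.
suff m : measurable_fun setT (fun z : V * V => (k (z.1 - z.2) * u z.2)%:E).
  have mf := @fine_measurable R _ measurableT.
  exact: measurableT_comp mf (measurable_fun_integral2 mu m).
apply/measurable_EFinP; apply: measurable_funM; last first.
  exact: measurableT_comp mu_ measurable_snd.
exact: measurableT_comp mk (measurable_rowB measurable_fst measurable_snd).
Qed.

Let integrable_kernel_mul (w : V -> R) : measurable_fun setT w ->
  \int[mu]_y (`|k y| * `|w y|)%:E < +oo ->
  mu.-integrable setT (fun y => (k y * w y)%:E).
Proof.
move=> mw woo; apply/integrableP; split.
  by apply/measurable_EFinP; exact: measurable_funM.
apply: le_lt_trans woo; rewrite le_eqVlt; apply/orP; left; apply/eqP.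
by apply: eq_integral => y _; rewrite abse_EFin normrM.
Qed.

Let norm_kernel_integral_le (w : V -> R) : measurable_fun setT w ->
  `|\int[mu]_y (k y * w y)%:E| <= \int[mu]_y (`|k y| * `|w y|)%:E.
Proof.
move=> mw; apply: le_trans (le_abse_integral _ _ _) _ => //.
  by apply/measurable_EFinP; exact: measurable_funM.
rewrite le_eqVlt; apply/orP; left; apply/eqP.
by apply: eq_integral => y _; rewrite abse_EFin normrM.
Qed.

Let measurable_shift_diff_at u x : measurable_fun setT u ->
  measurable_fun setT (fun y => shift_diff y u x).
Proof.
move=> mu_; apply: measurable_funB => //; apply: measurableT_comp mu_ _.
exact: measurable_rowD.
Qed.

Let measurable_shift_diffN_at u x : measurable_fun setT u ->
  measurable_fun setT (fun y => shift_diff (- y)%R u x).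
Proof.
move=> mu_; apply: measurable_funB => //.
exact: measurableT_comp mu_ (measurable_reflect x).
Qed.

Lemma convol_sub u x : measurable_fun setT u ->
  \int[mu]_y (`|k y| * `|shift_diff (- y)%R u x|)%:E < +oo ->
  (convol k u x - u x)%:E = \int[mu]_y (k y * shift_diff (- y)%R u x)%:E.
Proof.
move=> mu_ kfin.
have Gi := integrable_kernel_mul (measurable_shift_diffN_at x mu_) kfin.
have ui : mu.-integrable setT (fun y => (u x)%:E * (k y)%:E) by exact: integrableZl.
have E : \int[mu]_y (k y * u (x - y)%R)%:E =
    \int[mu]_y (k y * shift_diff (- y)%R u x)%:E + (u x)%:E.
  transitivity (\int[mu]_y ((k y * shift_diff (- y)%R u x)%:E + (u x)%:E * (k y)%:E)).
    apply: eq_integral => y _; rewrite -EFinM -EFinD /shift_diff; congr EFin; ring.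
  rewrite integralD// (integralZl _ ki)//; congr (_ + _).
  by rewrite [X in _ * X]k1 mule1.
rewrite EFinB convolE// E fineK; last by rewrite fin_numD integrable_fin_num.
by rewrite addeK.
Qed.

(** Valid at every point: where the right side is finite the identity
    [convol_sub] holds, elsewhere the bound is trivial. *)
Lemma convol_sub_le u x : measurable_fun setT u ->
  `|convol k u x - u x|%:E <= \int[mu]_y (`|k y| * `|shift_diff (- y)%R u x|)%:E.
Proof.
move=> mu_.
have [kfin|] := ltP (\int[mu]_y (`|k y| * `|shift_diff (- y)%R u x|)%:E) +oo; last first.
  by rewrite leye_eq => /eqP ->; rewrite leey.
rewrite -abse_EFin convol_sub//.
apply: (norm_kernel_integral_le (w := fun y => shift_diff (- y)%R u x)).
exact: measurable_shift_diffN_at.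
Qed.

(** By evenness the error is also the average of [shift_diff y u x], so twice
    the error is the average of the second difference. The factor 2 is given
    away. *)
Lemma convol_sub_even_le u x : measurable_fun setT u -> (forall y, k (- y)%R = k y) ->
  \int[mu]_y (`|k y| * `|shift_diff (- y)%R u x|)%:E < +oo ->
  `|convol k u x - u x|%:E <= \int[mu]_y (`|k y| * `|second_diff y u x|)%:E.
Proof.
move=> mu_ kN kfin; have C := convol_sub mu_ kfin.
have md := measurable_shift_diff_at x mu_; have mdN := measurable_shift_diffN_at x mu_.
have Gi := integrable_kernel_mul mdN kfin.
have C' : (convol k u x - u x)%:E = \int[mu]_y (k y * shift_diff y u x)%:E.
  rewrite C -[LHS](integral_reflect 0%R).
    by apply: eq_integral => y _; rewrite sub0r opprK kN.
  by apply/measurable_EFinP; exact: measurable_funM.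
have Gi' : mu.-integrable setT (fun y => (k y * shift_diff y u x)%:E).
  apply: integrable_kernel_mul => //.
  rewrite -[X in X < _](integral_reflect 0%R).
    by under eq_integral do rewrite sub0r kN.
  by apply/measurable_EFinP; apply: measurable_funM; exact: measurableT_comp.
have D : (convol k u x - u x + (convol k u x - u x))%:E =
    \int[mu]_y (k y * second_diff y u x)%:E.
  rewrite EFinD {1}C C' -integralD//; apply: eq_integral => y _.
  rewrite -EFinD /shift_diff /second_diff; congr EFin; ring.
apply: (@le_trans _ _ `|(convol k u x - u x + (convol k u x - u x))%:E|).
  by rewrite abse_EFin lee_fin -mulr2n normrMn mulr2n lerDl.
rewrite D; apply: norm_kernel_integral_le.
have := measurable_funD md mdN; congr measurable_fun; apply/funext => y.
by rewrite /second_diff /shift_diff/=; ring.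
Qed.

Let measurable_integral_norm (w : V * V -> R) : measurable_fun setT w ->
  measurable_fun setT (fun x => \int[mu]_y (`|k y| * `|w (x, y)|)%:E).
Proof.
move=> mw.
have m : measurable_fun setT (fun z : V * V => (`|k z.2| * `|w z|)%:E).
  apply/measurable_EFinP; apply: measurable_funM; last exact: measurableT_comp.
  by apply: measurableT_comp => //; exact: measurableT_comp mk measurable_snd.
exact: (measurable_fun_integral2 mu m).
Qed.

Let Lnorm_kernel_le (w : V * V -> R) p (A : \bar R) : 1 <= p -> measurable_fun setT w ->
  0 <= A -> (forall y, k y != 0%R -> 'N[mu]_p[(fun x => (w (x, y))%:E)] <= A) ->
  'N[mu]_p[(fun x => \int[mu]_y (`|k y| * `|w (x, y)|)%:E)] <= M%:E * A.
Proof.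
move=> p1 mw A0 wA; apply: (Lnorm_integral_le (g := fun y => `|k y|%R)) => //.
- exact: measurableT_comp.
- by move=> y; rewrite normr_eq0; exact: wA.
Qed.

Let integral_norm_ge0 (w : V -> R) : 0 <= \int[mu]_y (`|k y| * `|w y|)%:E.
Proof. by apply: integral_ge0 => y _; rewrite lee_fin mulr_ge0. Qed.

Let measurable_shift_diffN2 u : measurable_fun setT u ->
  measurable_fun setT (fun z : V * V => shift_diff (- z.2)%R u z.1).
Proof.
move=> mu_; apply: measurable_funB; last exact: measurableT_comp mu_ measurable_fst.
exact: measurableT_comp mu_ (measurable_rowB measurable_fst measurable_snd).
Qed.

Let measurable_convol_sub u : measurable_fun setT u ->
  measurable_fun setT (EFin \o (convol k u \- u)%R).
Proof.
move=> mu_; apply/measurable_EFinP; apply: measurable_funB => //.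
exact: measurable_convol.
Qed.

Lemma Lnorm_convol_sub p u (A : \bar R) : 1 <= p -> measurable_fun setT u ->
  0 <= A -> (forall y, k y != 0%R -> 'N[mu]_p[EFin \o shift_diff (- y)%R u] <= A) ->
  'N[mu]_p[EFin \o (convol k u \- u)%R] <= M%:E * A.
Proof.
move=> p1 mu_ A0 kA; have msd := measurable_shift_diffN2 mu_.
apply: le_trans (Lnorm_kernel_le p1 msd A0 kA).
apply: le_Lnorm => //.
- exact: measurable_convol_sub.
- exact: (measurable_integral_norm msd).
- apply: nearW => x; rewrite [leRHS]gee0_abs ?integral_norm_ge0//.
  exact: convol_sub_le.
Qed.

Lemma Lnorm_convol_sub_even p u (A : \bar R) : 1 <= p -> measurable_fun setT u ->
  'N[mu]_p[EFin \o u] < +oo -> (forall y, k (- y)%R = k y) ->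
  0 <= A -> (forall y, k y != 0%R -> 'N[mu]_p[EFin \o second_diff y u] <= A) ->
  'N[mu]_p[EFin \o (convol k u \- u)%R] <= M%:E * A.
Proof.
move=> p1 mu_ uoo kN A0 kA; have msd := measurable_shift_diffN2 mu_.
have ms2 : measurable_fun setT (fun z : V * V => second_diff z.2 u z.1).
  apply: measurable_funB; last first.
    by apply: measurable_funM => //; exact: measurableT_comp mu_ measurable_fst.
  apply: measurable_funD.
    exact: measurableT_comp mu_ (measurable_rowD measurable_fst measurable_snd).
  exact: measurableT_comp mu_ (measurable_rowB measurable_fst measurable_snd).
have fin1 : {ae mu, forall x, \int[mu]_y (`|k y| * `|shift_diff (- y)%R u x|)%:E < +oo}.
  apply: filterS (Lnorm_lty_ae p1 (measurable_integral_norm msd) _) => [x|].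
    by rewrite gee0_abs ?integral_norm_ge0.
  have A1 : 0 <= 2%:E * 'N[mu]_p[EFin \o u] by rewrite mule_ge0 ?Lnorm_ge0.
  apply: le_lt_trans (Lnorm_kernel_le p1 msd A1 _) _.
    by move=> y _; exact: (Lnorm_shift_diff_le2 (- y)%R p1 mu_).
  by rewrite lte_mul_pinfty ?lte_mul_pinfty ?lee_fin// -lee_fin -kM integral_ge0.
apply: le_trans (Lnorm_kernel_le p1 ms2 A0 kA).
apply: le_Lnorm => //.
- exact: measurable_convol_sub.
- exact: (measurable_integral_norm ms2).
- apply: filterS fin1 => x xfin; rewrite [leRHS]gee0_abs ?integral_norm_ge0//.
  exact: convol_sub_even_le.
Qed.

End kernel.
End convolution_error.

(** * The rate of mollification *)

Section rate.
Context {R : realType} (n : nat).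
Local Notation V := 'rV[R]_n.
Local Notation mu := (@lebesgue_row R n).
Implicit Types (u rho : V -> R) (p : \bar R).

(** The factor [n%:R] comes from [Lnorm_second_diff], that is, from the range
    [1 < s <= 2]. *)
Lemma mollification_rate_mass rho (M : R) : (0 < n)%N -> unit_kernel rho ->
  (\int[mu]_x `|rho x|%:E = M%:E)%E ->
  mollification_rate rho (M * (n%:R * gainC n)).
Proof.
move=> hn [rhoi rho1 rhoB] rhoM.
have mrho : measurable_fun setT rho by have /integrableP[/measurable_EFinP] := rhoi.
have C0 := gainC_gt0 (R := R) hn.
have M0 : 0 <= M by rewrite -lee_fin -rhoM integral_ge0.
have n1 : 1 <= n%:R :> R by rewrite ler1n.
have E0 e := measurable_rescale e mrho.
have E1 e : 0 < e -> (\int[mu]_y (rescale rho e y)%:E = 1)%E.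
  by move=> e0; rewrite integral_rescale.
have E2 e : 0 < e -> (\int[mu]_y `|rescale rho e y|%:E = M%:E)%E.
  by move=> e0; rewrite integral_norm_rescale.
have Lfun_fin p u : u \in Lfun mu p ->
    measurable_fun setT u /\ ('N[mu]_p[EFin \o u] < +oo)%E.
  by rewrite inE => /andP[]; rewrite !inE.
have first s : 0 <= s <= 1 -> mollification_estimate rho (M * (n%:R * gainC n)) s.
  move=> s01 p u e p1; have s1 : s <= 1 by case/andP: s01.
  rewrite /sobolev /seminorm s1 => -[/Lfun_fin[mu_ _] _] e0.
  have S0 := seminorm01_ge0 s u p1.
  apply: le_trans (Lnorm_convol_sub (E0 e) (E1 e e0) (E2 e e0) p1 mu_ (A := ((gainC n * e `^ s)%:E * seminorm01 s p u)%E) _ _) _.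
  - by rewrite mule_ge0// lee_fin mulr_ge0 ?powR_ge0// ltW.
  - move=> y ye; apply: Lnorm_shift_diff_seminorm01 => //.
    by rewrite normrN; exact: rescale_neq0 ye.
  - rewrite -muleA [(seminorm01 s p u * _)%E]muleC !muleA -!EFinM.
    rewrite lee_wpmul2r// lee_fin [leLHS]mulrA ler_wpM2r ?powR_ge0//.
    by rewrite ler_wpM2l// ler_peMl// ltW.
split => // rhoN s /andP[s0 s2].
have [s1|s1] := leP s 1; first by apply: first; rewrite s0.
move=> p u e p1; rewrite /sobolev [s <= 1]leNgt s1 /= => -[/Lfun_fin[mu_ uoo] u1 _] e0.
have wd : weakly_differentiable u.
  move: u1; rewrite /seminorm lexx /seminorm01 oner_eq0 eqxx.
  by case: asboolP.
have S0 : (0 <= seminorm s p u)%E.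
  rewrite /seminorm [s <= 1]leNgt s1 /=.
  apply: le_trans (le_bigmax -oo%E (fun i => seminorm01 (s - 1) p (weak_partial i u)) (Ordinal hn)).
  exact: seminorm01_ge0.
apply: le_trans (Lnorm_convol_sub_even (E0 e) (E1 e e0) (E2 e e0) p1 mu_ uoo (A := ((n%:R * gainC n * e `^ s)%:E * seminorm s p u)%E) _ _ _) _.
- by move=> y; rewrite /rescale scalerN rhoN.
- by rewrite mule_ge0// lee_fin mulr_ge0 ?powR_ge0// mulr_ge0// ltW.
- move=> y ye; apply: Lnorm_second_diff => //; first by rewrite s1.
  exact: rescale_neq0 ye.
- by rewrite -muleA [(seminorm s p u * _)%E]muleC !muleA -!EFinM; rewrite !mulrA.
Qed.

End rate.

(* A kernel rho may change sign. With a constant depending on n alone the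
   estimate is false for such kernels (s = 0, p = 1: the operator norm of
   u |-> rho_e * u - u is at least ||rho||_{L^1} - 1), so the first half gives
   C = C(n) for nonnegative kernels, and the second half gives, for an
   arbitrary kernel fixed beforehand, a C independent of s, p, u and e. *)
Theorem theorem2p3 (R : realType) (n : nat) (hn : (1 <= n)%N) :
  (exists C : R, forall rho : 'rV[R]_n -> R, unit_kernel rho ->
     (forall x, 0 <= rho x) -> mollification_rate rho C) /\
  (forall rho : 'rV[R]_n -> R, unit_kernel rho ->
     exists C : R, mollification_rate rho C).
Proof.
split.
  exists (1 * (n%:R * gainC n)) => rho rhok rho0.
  apply: mollification_rate_mass => //; have [_ <- _] := rhok.
  by apply: eq_integral => x _; rewrite ger0_norm.
move=> rho rhok; have [/integrableP[_ rhoi] _ _] := rhok.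
exists (fine (\int[lebesgue_row n]_x `|rho x|%:E) * (n%:R * gainC n)).
apply: mollification_rate_mass => //; rewrite fineK// ge0_fin_numE//.
exact: integral_ge0.
Qed.
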